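(* Consider the preferential attachment model with types described in the context with $S=\{1,2,3\}$, $$A=\begin{pmatrix}0&1&0\\0&0&1\\1&0&0\end{pmatrix},$$ and $\mu_i=\frac13$ for $i=1,2,3$. Let $m$ be an odd integer, and let the $p_k$ be given by the minority rule: $p_k=1$ for $0\le k\le\frac{m-1}{2}$ and $p_k=0$ for $\frac{m+1}{2}\le k\le m$. Then for $m\ge 7$, almost surely $\bigl(Z^{(t)}_1,Z^{(t)}_2,Z^{(t)}_3\bigr)$ does not converge to a limit as $t\to\infty$.
   Context: Model. $S=\{1,\dots,N\}$ is a finite set of communities, $m\ge 1$ is an integer, $\mu=(\mu_i)_{i\in S}$ is a probability distribution on $S$, and $A=(\alpha_{x,y})_{x,y\in S}$ (the attractiveness matrix) has non-negative entries with $\sum_x\alpha_{x,y}>0$ for every $y$. The type assignment rule is given by $p_0,\dots,p_m\in[0,1]$. $G_0$ is a fixed finite initial (multi)graph with $n_0$ vertices and $mn_0$ edges, all vertices having positive degree; each vertex $v$ has a community $c(v)\in S$ and a type (colour), red or blue, and each community contains at least one vertex of $G_0$. Given $G_t$, the graph $G_{t+1}$ is obtained by adding a vertex $v_{t+1}$ whose community $c(v_{t+1})$ has law $\mu$, independently of everything else, and $m$ edges from $v_{t+1}$ to $m$ existing vertices chosen independently with replacement, each choice being equal to vertex $v$ with probability $$\frac{\alpha_{c(v),c(v_{t+1})}\deg_{G_t}(v)}{\sum_{u\in V(G_t)}\alpha_{c(u),c(v_{t+1})}\deg_{G_t}(u)}.$$ Then, conditional on exactly $k$ of the $m$ chosen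 neighbours (with multiplicity) being red, $v_{t+1}$ becomes red with probability $p_k$ and otherwise blue; types never change afterwards. $Z^{(t)}_i=\dfrac{\sum_{v\text{ red},\,c(v)=i}\deg_{G_t}(v)}{\sum_{v:\,c(v)=i}\deg_{G_t}(v)}$ is the proportion of edge-ends in community $i$ at time $t$ which are at red vertices. *)

(* Defs.v *)
From mathcomp Require Import all_boot all_order all_algebra.
From mathcomp Require Import all_classical all_reals all_analysis.

Set Implicit Arguments.
Unset Strict Implicit.
Unset Printing Implicit Defensive.

Import Order.TTheory GRing.Theory Num.Theory.
Import numFieldNormedType.Exports.

Local Open Scope classical_set_scope.
Local Open Scope ring_scope.

(* A multigraph whose vertices carry a community in 'I_N and a colour (true for
   red).  A vertex is its position in [vertices]; vertices and edges are listed
   in order of arrival.  Loops and repeated edges are allowed. *)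
Record graph (N : nat) := Graph {
  vertices : seq ('I_N * bool);
  edges : seq (nat * nat)
}.

Section Graph.
Variables (N : nat) (g : graph N).

Definition nb_vertices : nat := size (vertices g).

Definition community (v : 'I_nb_vertices) : 'I_N := (tnth (in_tuple (vertices g)) v).1.

Definition red (v : 'I_nb_vertices) : bool := (tnth (in_tuple (vertices g)) v).2.

(* The number of edge-ends at v: a loop counts twice. *)
Definition deg (v : nat) : nat :=
  (\sum_(e <- edges g) ((e.1 == v) + (e.2 == v)))%N.

Definition initial_graph (m : nat) : Prop :=
  [/\ forall e, e \in edges g -> (e.1 < nb_vertices)%N /\ (e.2 < nb_vertices)%N,
      size (edges g) = (m * nb_vertices)%N,
      forall v : 'I_nb_vertices, (0 < deg v)%N &
      forall i : 'I_N, exists v : 'I_nb_vertices, community v = i].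

(* The new vertex is numbered [nb_vertices]; us lists its chosen neighbours,
   with multiplicity. *)
Definition add_vertex (c : 'I_N) (us : seq nat) (b : bool) : graph N :=
  Graph (rcons (vertices g) (c, b)) (edges g ++ [seq (nb_vertices, u) | u <- us]).

Definition red_proportion (R : realType) (i : 'I_N) : R :=
  (\sum_(v < nb_vertices | red v && (community v == i)) deg v)%N%:R /
  (\sum_(v < nb_vertices | community v == i) deg v)%N%:R.

End Graph.

Section Model.
Variables (R : realType) (N m : nat).
Variables (mu : 'I_N -> R) (alpha : 'M[R]_N) (p : nat -> R).

Definition choice_prob (g : graph N) (c : 'I_N) (v : 'I_(nb_vertices g)) : R :=
  alpha (community v) c * (deg g v)%:R /
  \sum_(u < nb_vertices g) alpha (community u) c * (deg g u)%:R.

Definition colour_prob (k : nat) (b : bool) : R := if b then p k else 1 - p k.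

Definition step_prob (g : graph N) (c : 'I_N) (us : m.-tuple 'I_(nb_vertices g))
    (b : bool) : R :=
  mu c * (\prod_(u <- us) choice_prob c u) * colour_prob (count (@red N g) us) b.

(* The conditional law of G (t + 1) given G 0, ..., G t, stated without
   conditioning on null events: h is a possible history up to time t.  Distinct
   (c, us, b) give distinct graphs, so each step_prob is the conditional
   probability of a single value of G (t + 1). *)
Record attachment_process (G0 : graph N) (d : measure_display)
    (T : measurableType d) (P : probability T R) (G : nat -> T -> graph N) :
    Prop := AttachmentProcess {
  attachment_measurable :
    forall t g, measurable [set w | G t w = g];
  attachment_initial :
    forall w, G 0%N w = G0;
  attachment_step :
    forall (t : nat) (h : nat -> graph N)
           (c : 'I_N) (us : m.-tuple 'I_(nb_vertices (h t))) (b : bool),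
    P [set w | (forall s, (s <= t)%N -> G s w = h s) /\
               G t.+1 w = add_vertex (h t) c (map val us) b] =
    (P [set w | forall s, (s <= t)%N -> G s w = h s] *
     (step_prob c us b)%:E)%E
}.

End Model.

Definition cyclic_attractiveness (R : realType) : 'M[R]_3 :=
  \matrix_(x < 3, y < 3)
    nth 0 (nth [::] [:: [:: 0; 1; 0];
                        [:: 0; 0; 1];
                        [:: 1; 0; 0]] x) y.

Definition uniform_communities (R : realType) (i : 'I_3) : R := 3%:R^-1.

Definition minority_rule (R : realType) (m k : nat) : R :=
  if (k <= (m.-1)./2)%N then 1 else 0.

(* Main.v *)
Require Import Defs.
From HB Require Import structures.
From mathcomp Require Import all_boot all_order all_algebra.
From mathcomp Require Import all_classical all_reals all_analysis.
From mathcomp Require Import ring lra zify.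

Set Implicit Arguments.
Unset Strict Implicit.
Unset Printing Implicit Defensive.

Import Order.TTheory GRing.Theory Num.Theory.
Import numFieldNormedType.Exports.

Local Open Scope classical_set_scope.
Local Open Scope ring_scope.

(** Write [Z i] for the proportion of red edge-ends in community [i]. A newcomer
    of community [c] draws all its neighbours from [prev c], each of them red with
    probability [Z (prev c)], so it is red with probability [f (Z (prev c))], where
    [f = red_prob n] is the probability that at most [n] of [m = 2 n + 1] trials
    succeed. The vector [Z] follows, with steps of order [1 / t], the differential
    equation in which [Z i] is driven towards [f (Z (prev i))].

    A limit must be a zero of this field: if [f (Z (prev i)) - Z i] stayed away from
    zero with a constant sign, [Z i] would move like a harmonic series although it is
    bounded ([off_equilibrium_negligible]). As [f] is nonincreasing, [f \o f \o f] has
    the single fixed point [1/2] ([equilibrium_half]), so the only candidate is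
    [(1/2, 1/2, 1/2)].

    There, [f] has derivative [- s] with [s > 2] as soon as [m >= 7]
    ([minority_slope_gt2]). The linearized field is circulant: it contracts along the
    diagonal and expands, while rotating, in the plane orthogonal to it, with
    exponent proportional to [s / 2 - 1]. The whole diagonal is invariant, hence the
    squared distance to it is a good measure of instability even far from the
    equilibrium. In terms of the excesses [Y i] (red edge-ends minus half of the
    edge-ends), put [Q = quad Y]. The noise is isotropic in the expanding plane, by
    the cyclic symmetry, and the logarithm of the norm is harmonic in the plane;
    therefore the noise does not hinder the growth of [ln (Q + M * t)], whose mean
    increases by more than [(2 + eta / 2) / t] at each step near the equilibrium
    ([log_growth_lb], [lyap_step]). Since [Q] is at most of order [t ^+ 2], this cannot last
    for ever ([near_half_negligible]). The sizes of the communities fluctuate and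
    perturb the linearization; a term [beta * F / t], where [F] is the sum of the
    squared fluctuations, compensates for this.

    Both arguments are instances of [drift_negligible]: a function of the state that
    is a supermartingale as long as the state stays in a region, and that is bounded below
    by a function of time tending to infinity, forbids staying in the region for ever.
    All means in it are finite sums over the outcomes of one step. *)

(** * Means of functions of a binomial variable *)

Section BinomialMean.
Variable R : realType.
Implicit Types (n k : nat) (z : R) (phi psi : nat -> R).

(** The mean of [phi k], for [k] the number of successes in [n] independent trials of
    probability [z]. The recursion conditions on the first trial, as a sum over
    tuples of neighbours does. *)
Fixpoint bin_mean n z phi : R :=
  if n is n'.+1 then
    z * bin_mean n' z (fun k => phi k.+1) + (1 - z) * bin_mean n' z phi
  else phi 0%N.

Lemma bin_meanS n z phi : bin_mean n.+1 z phi =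
  z * bin_mean n z (fun k => phi k.+1) + (1 - z) * bin_mean n z phi.
Proof. by []. Qed.

Lemma eq_bin_mean n z phi psi :
  (forall k, (k <= n)%N -> phi k = psi k) -> bin_mean n z phi = bin_mean n z psi.
Proof.
elim: n phi psi => [|n IHn] phi psi eq_phi /=; first exact: eq_phi.
by congr (_ * _ + _ * _); apply: IHn => k lekn; apply: eq_phi => //; exact: leqW.
Qed.

Lemma bin_meanD n z phi psi :
  bin_mean n z (fun k => phi k + psi k) = bin_mean n z phi + bin_mean n z psi.
Proof. by elim: n phi psi => [//|n IHn] phi psi /=; rewrite !IHn; ring. Qed.

Lemma bin_meanZ n z a phi :
  bin_mean n z (fun k => a * phi k) = a * bin_mean n z phi.
Proof. by elim: n phi => [//|n IHn] phi /=; rewrite !IHn; ring. Qed.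

Lemma bin_mean_cst n z a : bin_mean n z (fun=> a) = a.
Proof. by elim: n => [//|n IHn] /=; rewrite IHn; ring. Qed.

Lemma bin_meanB n z phi psi :
  bin_mean n z (fun k => phi k - psi k) = bin_mean n z phi - bin_mean n z psi.
Proof. by elim: n phi psi => [//|n IHn] phi psi /=; rewrite !IHn; ring. Qed.

Lemma bin_mean_id n z : bin_mean n z (fun k => k%:R) = n%:R * z.
Proof.
elim: n => [|n IHn] /=; first by rewrite mul0r.
rewrite (@eq_bin_mean _ _ (fun k => k.+1%:R) (fun k => k%:R + 1)); last first.
  by move=> k _; rewrite -natr1.
by rewrite bin_meanD bin_mean_cst IHn -natr1; ring.
Qed.

Lemma le_bin_mean n z phi psi : 0 <= z <= 1 ->
  (forall k, (k <= n)%N -> phi k <= psi k) -> bin_mean n z phi <= bin_mean n z psi.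
Proof.
move=> /andP[z0 z1].
elim: n phi psi => [|n IHn] phi psi le_phi /=; first exact: le_phi.
by rewrite lerD// ler_wpM2l ?subr_ge0// IHn// => k lekn; apply: le_phi => //; exact: leqW.
Qed.

(** Exchanging successes and failures replaces [z] by [1 - z]. *)
Lemma bin_mean_rev n z phi :
  bin_mean n z (fun k => phi (n - k)%N) = bin_mean n (1 - z) phi.
Proof.
elim: n phi => [//|n IHn] phi /=.
rewrite (@eq_bin_mean _ _ (fun k => phi (n.+1 - k.+1)%N) (fun k => phi (n - k)%N))//.
rewrite (@eq_bin_mean _ _ (fun k => phi (n.+1 - k)%N)
  (fun k => (fun j => phi j.+1) (n - k)%N)); last first.
  by move=> k lekn /=; rewrite subSn.
by rewrite (IHn phi) (IHn (fun j => phi j.+1)); ring.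
Qed.

Lemma bin_mean_pred1 n z j :
  bin_mean n z (fun k => (k == j)%:R) = 'C(n, j)%:R * z ^+ j * (1 - z) ^+ (n - j).
Proof.
elim: n j => [|n IHn] j /=.
  by case: j => [|j]; rewrite ?bin0 ?expr0 ?mul1r// bin0n !mul0r.
case: j => [|j].
  rewrite (@eq_bin_mean _ _ (fun k => (k.+1 == 0)%:R) (fun=> 0))//.
  by rewrite bin_mean_cst IHn !bin0 subn0 subn0 exprS; ring.
rewrite (@eq_bin_mean _ _ (fun k => (k.+1 == j.+1)%:R) (fun k => (k == j)%:R))//.
rewrite !IHn binS natrD subSS.
have [ltjn|lenj] := ltnP j n.
  rewrite -(subnSK ltjn) !exprS.
  move: (z ^+ j) ((1 - z) ^+ (n - j.+1)) ('C(n, j)%:R) ('C(n, j.+1)%:R) => a b c d.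
  by ring.
by rewrite (@bin_small n j.+1)// exprS; ring.
Qed.

(** Bernstein's formula: moving [z] changes each of the [n] trials at the same rate,
    and a changed trial turns [k] successes of the others into [k + 1]. *)
Lemma is_derive_bin_mean n z phi :
  is_derive z 1 (fun y => bin_mean n y phi)
    (n%:R * bin_mean n.-1 z (fun k => phi k.+1 - phi k)).
Proof.
elim: n phi => [|n IHn] phi /=.
  by rewrite mul0r; exact: is_derive_cst.
pose a := n%:R * bin_mean n.-1 z (fun k => phi k.+2 - phi k.+1).
pose b := n%:R * bin_mean n.-1 z (fun k => phi k.+1 - phi k).
have Ha : is_derive z 1 (fun y => bin_mean n y (fun k => phi k.+1)) a by exact: IHn.
have Hb : is_derive z 1 (fun y => bin_mean n y phi) b by exact: IHn.
have D1 : is_derive z 1 (fun y : R => y * bin_mean n y (fun k => phi k.+1))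
    (z * a + bin_mean n z (fun k => phi k.+1) * 1).
  exact: is_deriveM.
have D2 : is_derive z 1 (fun y : R => (1 - y) * bin_mean n y phi)
    ((1 - z) * b + bin_mean n z phi * (0 - 1)).
  exact: is_deriveM.
apply: (is_derive_eq (is_deriveD D1 D2)).
rewrite /= -natr1 bin_meanB /a /b.
case: n {IHn a b Ha Hb D1 D2} => [|n] /=; first by ring.
by rewrite !bin_meanB; ring.
Qed.

Lemma bin_mean_mvt n phi (a b : R) : a <= b -> exists2 c, a <= c <= b &
  bin_mean n b phi - bin_mean n a phi =
  n%:R * bin_mean n.-1 c (fun k => phi k.+1 - phi k) * (b - a).
Proof.
move=> leab.
have [c cab eqc] := MVT_segment leab (fun x _ => is_derive_bin_mean n x phi)
  (derivable_within_continuous (fun x _ => @ex_derive _ _ _ _ _ _ _ (is_derive_bin_mean n x phi))).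
by exists c => //; rewrite -in_itv.
Qed.

End BinomialMean.

Arguments bin_mean : simpl never.

(** * The minority rule *)

Section MinorityRule.
Variable R : realType.

(** The derivative is [n] times a mean of differences of [phi]. *)
Lemma bin_mean_lipschitz n (phi : nat -> R) (B a b : R) :
  (forall k, (k <= n)%N -> `|phi k| <= B) -> 0 <= a <= 1 -> 0 <= b <= 1 ->
  `|bin_mean n a phi - bin_mean n b phi| <= 2 * n%:R * B * `|a - b|.
Proof.
move=> phiB; wlog leba : a b / b <= a.
  move=> ih a01 b01; have [/ih|/ltW/ih] := leP b a; first exact.
  by rewrite distrC (distrC a) => {}ih; exact: ih.
move=> /andP[a0 a1] /andP[b0 b1].
have [c /andP[bc ca] ->] := bin_mean_mvt n phi leba.
rewrite normrM ler_wpM2r// normrM normr_nat.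
case: n phiB => [|n] phiB; first by rewrite mulr0 !mul0r.
rewrite (mulrC 2) -mulrA ler_wpM2l//.
have twoB : 2 * B = B + B by ring.
have c01 : 0 <= c <= 1 by rewrite (le_trans b0 bc) (le_trans ca).
have dphi k : (k <= n)%N -> `|phi k.+1 - phi k| <= 2 * B.
  move=> lekn; apply: (le_trans (ler_normB _ _)).
  by rewrite twoB lerD// phiB// leqW.
have dphi_itv k : (k <= n)%N -> - (2 * B) <= phi k.+1 - phi k <= 2 * B.
  by move=> /dphi; rewrite ler_norml.
rewrite ler_norml; apply/andP; split.
  by rewrite -[leLHS](bin_mean_cst n c) le_bin_mean// => k /dphi_itv/andP[].
by rewrite -[leRHS](bin_mean_cst n c) le_bin_mean// => k /dphi_itv/andP[].
Qed.

Variable n : nat.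
Local Notation m := n.*2.+1.

(** The probability that a newcomer is red, when its neighbours are red independently
    with probability [z]. *)
Definition red_prob (z : R) : R := bin_mean m z (minority_rule R m).

(** Minus the derivative of [red_prob] at [1/2]; see [red_prob_mvt]. *)
Definition minority_slope : R := m%:R * 'C(n.*2, n)%:R / 4 ^+ n.

Lemma minority_ruleE k : minority_rule R m k = (k <= n)%:R.
Proof. by rewrite /minority_rule /= doubleK; case: ifP. Qed.

(** At most [n] of the [2 n + 1] trials succeed if and only if more than [n] of them
    fail, and both kinds of outcomes have the same law at [1/2]. *)
Lemma red_prob_half : red_prob (1/2) = 1/2.
Proof.
have : red_prob (1/2) = 1 - red_prob (1/2); last by lra.
have -> : 1 - red_prob (1/2) = bin_mean m (1/2) (fun k => 1 - minority_rule R m k).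
  by rewrite bin_meanB bin_mean_cst.
rewrite /red_prob.
rewrite -[X in bin_mean m X _ = _](_ : 1 - 1/2 = 1/2 :> R); last by field.
rewrite -bin_mean_rev; apply: eq_bin_mean => k lekm; rewrite !minority_ruleE.
have -> : (m - k <= n)%N = ~~ (k <= n)%N by lia.
by case: (k <= n)%N; rewrite /= ?subrr ?subr0.
Qed.

(** The differences of the indicator of [k <= n] are concentrated at [k = n], so that
    the derivative is a single binomial probability. *)
Lemma red_prob_mvt a b : a <= b -> exists2 c, a <= c <= b &
  red_prob b - red_prob a = - (minority_slope * (4 * (c * (1 - c))) ^+ n * (b - a)).
Proof.
move=> leab; have [c cab eqc] := bin_mean_mvt m (minority_rule R m) leab.
exists c => //; rewrite /red_prob eqc /=.
rewrite (@eq_bin_mean _ _ _ _ (fun k => -1 * (k == n)%:R)); last first.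
  move=> k _; rewrite !minority_ruleE.
  by case: (ltngtP k n) => _ /=; rewrite ?subrr ?mulr0 ?sub0r ?mulr1.
rewrite bin_meanZ bin_mean_pred1 (_ : (n.*2 - n)%N = n); last by lia.
rewrite /minority_slope !exprMn.
have : 4 ^+ n != 0 :> R by rewrite expf_neq0// pnatr_eq0.
move: (4 ^+ n) (c ^+ n) ((1 - c) ^+ n) ('C(_, _)%:R : R) (m%:R : R) => u v w x y u0.
by field.
Qed.

Lemma minority_slope_ge0 : 0 <= minority_slope.
Proof. by rewrite /minority_slope divr_ge0 ?mulr_ge0 ?exprn_ge0. Qed.

Lemma red_prob_nincr a b : 0 <= a -> a <= b -> b <= 1 -> red_prob b <= red_prob a.
Proof.
move=> a0 leab b1; rewrite -subr_le0; have [c /andP[ac cb] ->] := red_prob_mvt leab.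
rewrite oppr_le0 !mulr_ge0 ?minority_slope_ge0 ?subr_ge0// exprn_ge0// !mulr_ge0//.
  exact: le_trans ac.
by rewrite subr_ge0 (le_trans cb).
Qed.

Lemma bernoulli_ineq k (y : R) : 0 <= y <= 1 -> 1 - k%:R * y <= (1 - y) ^+ k.
Proof.
move=> /andP[y0 y1]; elim: k => [|k IHk]; first by rewrite expr0 mul0r subr0.
rewrite exprS; apply: (@le_trans _ _ ((1 - y) * (1 - k%:R * y))); last first.
  by rewrite ler_wpM2l// subr_ge0.
rewrite -natr1; have : 0 <= k%:R * y * y by rewrite !mulr_ge0.
by lra.
Qed.

(** Within [d] of [1/2], the factor [4 * c * (1 - c)] is at least [1 - 2 * d], and
    Bernoulli's inequality controls its [n]-th power. *)
Lemma red_prob_near_half (d a b : R) : 0 <= d <= 1/2 ->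
  `|a - 1/2| <= d -> `|b - 1/2| <= d ->
  `|red_prob a - red_prob b + minority_slope * (a - b)|
    <= 2 * n%:R * minority_slope * d * `|a - b|.
Proof.
move=> /andP[d0 d1]; wlog leba : a b / b <= a.
  move=> ih ad bd; have [/ih|/ltW/ih] := leP b a; first exact.
  move=> /(_ bd ad); rewrite (distrC b); apply: le_trans.
  by rewrite -normrN le_eqVlt; apply/orP/or_introl/eqP; congr (`|_|); ring.
move=> ad bd.
have [c /andP[bc ca] ->] := red_prob_mvt leba.
rewrite -mulNr -mulrDl normrM ler_wpM2r//.
have s0 := minority_slope_ge0.
rewrite addrC -[X in `|X - _|]mulr1 -mulrBr normrM (ger0_norm s0).
rewrite (_ : 2 * n%:R * _ * d = minority_slope * (n%:R * (2 * d))); last by ring.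
rewrite ler_wpM2l//.
move: ad bd; rewrite !ler_norml => /andP[ad1 ad2] /andP[bd1 bd2].
set y := (2 * c - 1) ^+ 2.
have -> : 4 * (c * (1 - c)) = 1 - y by rewrite /y; ring.
have y0 : 0 <= y by exact: sqr_ge0.
have yd : y <= 2 * d.
  have : 0 <= (2 * d - (2 * c - 1)) * (2 * d + (2 * c - 1)) by apply: mulr_ge0; lra.
  have : 0 <= d * (1 - 2 * d) by apply: mulr_ge0; lra.
  by rewrite /y; lra.
have y1 : y <= 1 by lra.
have := @bernoulli_ineq n y; rewrite y0 y1 => /(_ isT).
have : (1 - y) ^+ n <= 1 by apply: exprn_ile1; lra.
have : n%:R * y <= n%:R * (2 * d) by exact: ler_wpM2l.
have : 0 <= n%:R * y by rewrite mulr_ge0.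
by move=> *; apply/andP; split; lra.
Qed.

End MinorityRule.

(** The slope increases with [n], by the factor [(2 n + 3) / (2 n + 2)], and it is
    [35 / 16] for [n = 3]. *)
Lemma minority_slope_gt2 (R : realType) n : (3 <= n)%N -> 2 < minority_slope R n.
Proof.
elim: n => // n IHn; rewrite leq_eqVlt => /predU1P[<-|/IHn {}IHn].
  have -> : minority_slope R 3 = 7%:R * 20%:R / 64%:R.
    by rewrite /minority_slope (_ : 'C(3.*2, 3) = 20%N)// -natrX.
  by rewrite ltr_pdivlMr// -!natrM ltr_nat.
have binS2 : (n.+1 * 'C(n.+1.*2, n.+1) = 2 * n.*2.+1 * 'C(n.*2, n))%N.
  have := mul_bin_diag n.*2.+2 n; have := mul_bin_down n.*2.+1 n.
  rewrite doubleS /= (_ : n.*2.+1 - n = n.+1)%N; last by lia.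
  by move=> e1 e2; rewrite -e2 -mulnA e1; lia.
have {}binS2 : 'C(n.+1.*2, n.+1)%:R = 2 * n.*2.+1%:R * 'C(n.*2, n)%:R / n.+1%:R :> R.
  by apply: (canRL (mulfK _)); rewrite ?pnatr_eq0// -!natrM mulnC binS2.
apply: (lt_trans IHn); rewrite /minority_slope binS2.
set C := 'C(_, _)%:R; set F := 4 ^+ n.
have F0 : 0 < F by rewrite exprn_gt0.
have C0 : 0 < C by rewrite ltr0n bin_gt0 -addnn leq_addr.
rewrite exprS -subr_gt0.
have -> : n.+1.*2.+1%:R * (2 * n.*2.+1%:R * C / n.+1%:R) / (4 * F) - n.*2.+1%:R * C / F
   = (C / F) * n.*2.+1%:R / (2 * n.+1%:R) :> R.
  rewrite (_ : n.+1.*2.+1%:R = 2 * n%:R + 3 :> R); last first.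
    by rewrite -natrM -natrD; congr (_%:R); lia.
  rewrite (_ : n.*2.+1%:R = 2 * n%:R + 1 :> R); last first.
    by rewrite -natrM natr1; congr (_%:R); lia.
  have : n.+1%:R != 0 :> R by rewrite pnatr_eq0.
  by rewrite -natr1 => n0; field; rewrite n0 gt_eqF.
by apply: divr_gt0; apply: mulr_gt0; rewrite // divr_gt0.
Qed.

(** * Drift criterion for leaving a region *)

Section FiniteUnion.
Variables (R : realType) (d : measure_display) (T : measurableType d).
Variables (P : {measure set T -> \bar R}) (I : finType) (F : I -> set T).
Hypothesis mF : forall i, measurable (F i).

Let fsbig_finType (f : I -> \bar R) : (\sum_(i \in [set: I]) f i = \sum_i f i)%E.
Proof.
rewrite -big_enum/= [RHS]fsbig_seq; last exact: enum_uniq.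
by apply: eq_fsbigl; apply/seteqP; split => // i _; rewrite /= mem_enum.
Qed.

Lemma finU_measurable : measurable (\bigcup_i F i).
Proof. by apply: fin_bigcup_measurable => //; exact: finite_finset. Qed.

Lemma measure_finU : trivIset setT F -> P (\bigcup_i F i) = (\sum_i P (F i))%E.
Proof.
move=> trivF; rewrite measure_fin_bigcup ?fsbig_finType//.
exact: finite_finset.
Qed.

Lemma measure_finU_le : (P (\bigcup_i F i) <= \sum_i P (F i))%E.
Proof.
rewrite -(fsbig_finType (fun i => P (F i))).
apply: content_sub_fsum => //; first exact: finite_finset.
exact: finU_measurable.
Qed.

End FiniteUnion.

Section StepMean.
Variables (R : realType) (N m : nat).
Variables (mu : 'I_N -> R) (alpha : 'M[R]_N) (p : nat -> R).
Implicit Types (g : graph N) (Phi Psi : graph N -> R).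

(** What is drawn at a step from [g]: a community, the neighbours, and a colour. *)
Definition outcome g := ('I_N * m.-tuple 'I_(nb_vertices g) * bool)%type.

Definition outcome_prob g (a : outcome g) : R := step_prob mu alpha p a.1.1 a.1.2 a.2.

Definition outcome_graph g (a : outcome g) : graph N :=
  add_vertex g a.1.1 (map val a.1.2) a.2.

Lemma outcome_graph_inj g : injective (@outcome_graph g).
Proof.
move=> [[c us] b] [[c' us'] b'] [] /rcons_inj[-> ->] /eqP.
rewrite eqseq_cat// => /andP[_ /eqP eq_edges]; congr (_, _, _).
have inj_edge : injective (fun u : nat => (nb_vertices g, u)) by move=> u v [].
exact/val_inj/(inj_map val_inj)/(inj_map inj_edge).
Qed.

Definition step_mean g Phi : R :=
  \sum_(a : outcome g) outcome_prob a * Phi (outcome_graph a).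

Lemma le_step_mean g Phi Psi : (forall a : outcome g, 0 <= outcome_prob a) ->
  (forall a : outcome g, Phi (outcome_graph a) <= Psi (outcome_graph a)) ->
  step_mean g Phi <= step_mean g Psi.
Proof. by move=> prob_ge0 le_phi; apply: ler_sum => a _; rewrite ler_wpM2l. Qed.

End StepMean.

Section Drift.
Variables (R : realType) (N m : nat).
Variables (mu : 'I_N -> R) (alpha : 'M[R]_N) (p : nat -> R).
Variables (G0 : graph N) (d : measure_display) (T : measurableType d).
Variables (P : probability T R) (G : nat -> T -> graph N).
Hypothesis process : attachment_process m mu alpha p G0 P G.

Variable inv : nat -> graph N -> Prop.
Hypothesis inv0 : inv 0 G0.
Hypothesis inv_step : forall t g (a : outcome m g), inv t g -> inv t.+1 (outcome_graph a).
Hypothesis prob_ge0 :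
  forall t g (a : outcome m g), inv t g -> 0 <= outcome_prob mu alpha p a.
Hypothesis prob_sum1 :
  forall t g, inv t g -> \sum_(a : outcome m g) outcome_prob mu alpha p a = 1.

Local Notation step_mean := (@step_mean R N m mu alpha p).

Variables (A : nat -> graph N -> Prop) (n : nat).

(** The probability, for the process started from [g] at time [t], that the state
    belongs to [A] from time [t] to time [t + k], where [A] imposes nothing before
    time [n]. The backward recursion makes it a function of the state, so that no
    conditional expectation is needed. *)
Fixpoint stay k t g : R :=
  if `[< (t < n)%N \/ A t g >] then
    if k is k'.+1 then step_mean g (stay k' t.+1) else 1
  else 0.

Lemma stay_ge0 k t g : inv t g -> 0 <= stay k t g.
Proof.
elim: k t g => [|k IHk] t g Ig /=; case: ifP => // _.
by apply: sumr_ge0 => a _; rewrite mulr_ge0 ?(prob_ge0 _ Ig)// IHk//; exact: inv_step.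
Qed.

Definition history t (h : nat -> graph N) : set T :=
  [set w | forall s, (s <= t)%N -> G s w = h s].

Lemma measurable_history t h : measurable (history t h).
Proof.
rewrite (_ : history t h = \bigcap_(s in `I_t.+1) [set w | G s w = h s]); last first.
  by apply/seteqP; split.
by apply: bigcap_measurable => [|s _]; [exists 0%N|exact: (attachment_measurable process)].
Qed.

Definition extend t (h : nat -> graph N) (a : outcome m (h t)) : nat -> graph N :=
  fun s => if (s <= t)%N then h s else outcome_graph a.
Arguments extend : clear implicits.

Lemma history_extend t h a : history t.+1 (extend t h a) =
  [set w | (forall s, (s <= t)%N -> G s w = h s) /\ G t.+1 w = outcome_graph a].
Proof.
apply/seteqP; split => w /=.
  move=> Hw; split=> [s lest|]; last by rewrite Hw// /extend ltnn.
  by rewrite Hw ?(leq_trans lest)// /extend lest.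
move=> [Hw Ew] s; rewrite leq_eqVlt => /predU1P[->|].
  by rewrite /extend ltnn Ew.
by rewrite ltnS => lest; rewrite /extend lest Hw.
Qed.

Lemma history_extendE t h a :
  P (history t.+1 (extend t h a)) =
  (P (history t h) * (outcome_prob mu alpha p a)%:E)%E.
Proof. by rewrite history_extend; exact: (attachment_step process). Qed.

Lemma trivIset_extend t h : trivIset setT (fun a => history t.+1 (extend t h a)).
Proof.
apply/trivIsetP => a b _ _ /eqP ab; apply/seteqP; split => // w [].
rewrite !history_extend => -[_ Ea] [_ Eb].
by apply: ab; apply: outcome_graph_inj; rewrite -Ea.
Qed.

(** The continuations of a history are disjoint and their probabilities add up to the
    probability of the history. *)
Lemma measure_no_extend t h : inv t (h t) ->
  P (history t h `\` \bigcup_a history t.+1 (extend t h a)) = 0.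
Proof.
move=> Ih; have mH s k : measurable (history s k) by exact: measurable_history.
pose U := \bigcup_a history t.+1 (extend t h a).
have -> : P (history t h `\` U) = (P (history t h) - P U)%E.
  rewrite measureD//; [|exact: finU_measurable|].
    by rewrite setIidr// => w [a _]; rewrite history_extend => -[].
  by rewrite -ge0_fin_numE// fin_num_measure.
have -> : P U = (\sum_a P (history t.+1 (extend t h a)))%E.
  by apply: measure_finU => //; exact: trivIset_extend.
under eq_bigr do rewrite history_extendE.
rewrite -ge0_sume_distrr; last by move=> a _; rewrite lee_fin (prob_ge0 _ Ih).
by rewrite sumEFin (prob_sum1 Ih) mule1 subee// fin_num_measure.
Qed.

(** By induction on [k], splitting along the possible next graphs. The set is covered by an
    event of small probability, since [A] need not be measurable. *)
Lemma cover_stay k t h : inv t (h t) -> exists E, [/\ measurable E,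
  [set w | history t h w /\
     forall s, (t <= s <= t + k)%N -> (s < n)%N \/ A s (G s w)] `<=` E &
  (P E <= P (history t h) * (stay k t (h t))%:E)%E].
Proof.
elim: k t h => [|k IHk] t h Ih /=; case: asboolP => At.
- exists (history t h); split; [exact: measurable_history|by move=> w []|].
  by rewrite mule1.
- exists set0; split; [exact: measurable0| |by rewrite measure0 mule0].
  move=> w [Hw /(_ t)]; rewrite leqnn addn0 leqnn => /(_ isT).
  by rewrite Hw// => /At.
- have extE a : extend t h a t.+1 = outcome_graph a by rewrite /extend ltnn.
  have /choice[E HE] : forall a : outcome m (h t), exists E, [/\ measurable E,
      [set w | history t.+1 (extend t h a) w /\
         forall s, (t.+1 <= s <= t.+1 + k)%N -> (s < n)%N \/ A s (G s w)] `<=` E &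
      (P E <= P (history t.+1 (extend t h a)) * (stay k t.+1 (outcome_graph a))%:E)%E].
    move=> a; have := IHk t.+1 (extend t h a); rewrite extE; apply.
    exact: inv_step.
  pose N0 := history t h `\` \bigcup_a history t.+1 (extend t h a).
  have mN0 : measurable N0.
    apply: measurableD; first exact: measurable_history.
    by apply: finU_measurable => a; exact: measurable_history.
  have mE : measurable (\bigcup_a E a).
    by apply: finU_measurable => a; have [] := HE a.
  exists (N0 `|` \bigcup_a E a); split; first exact: measurableU.
    move=> w [Hw Aw]; have [[a _ Hwa]|nHw] :=
      pselect ((\bigcup_a history t.+1 (extend t h a)) w); [right|by left].
    exists a => //; have [_ subE _] := HE a; apply: subE; split=> // s /andP[ts sk].
    by apply: Aw; rewrite (ltnW ts) -addSnnS.
  rewrite setUC measureU0//; last exact: measure_no_extend.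
  apply: (@le_trans _ _ (\sum_a P (E a))%E).
    by apply: measure_finU_le => // a; have [] := HE a.
  rewrite /step_mean -sumEFin ge0_sume_distrr; last first.
    move=> a _; rewrite lee_fin mulr_ge0 ?(prob_ge0 _ Ih)// stay_ge0//.
    exact: inv_step.
  apply: lee_sum => a _; have [_ _ leE] := HE a; apply: (le_trans leE).
  by rewrite history_extendE -muleA -EFinM.
- exists set0; split; [exact: measurable0| |by rewrite measure0 mule0].
  move=> w [Hw /(_ t)]; rewrite leqnn leq_addr => /(_ isT).
  by rewrite Hw// => /At.
Qed.

Variables (V : nat -> graph N -> R) (bnd : nat -> R).
Hypothesis bnd_ge0 : forall t, (n <= t)%N -> 0 <= bnd t.
Hypothesis bnd_le : forall t g, (n <= t)%N -> inv t g -> bnd t <= V t g.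
Hypothesis V_super : forall t g, (n <= t)%N -> inv t g -> A t g ->
  step_mean g (V t.+1) <= V t g.
Hypothesis bnd_cvg : bnd @ \oo --> +oo.

(** Optional stopping: on the event of staying in [A] until time [t + k], the value
    [V] has reached at least [bnd (t + k)]. *)
Lemma stay_bnd k t g : (n <= t)%N -> inv t g -> stay k t g * bnd (t + k) <= V t g.
Proof.
elim: k t g => [|k IHk] t g lent Ig /=; case: asboolP => At; last 1 first.
- by rewrite mul0r (le_trans (bnd_ge0 lent))// bnd_le.
- by rewrite mul1r addn0 bnd_le.
- by rewrite mul0r (le_trans (bnd_ge0 lent))// bnd_le.
case: At => [|At]; first by rewrite ltnNge lent.
apply: le_trans (V_super lent Ig At); rewrite mulr_suml.
apply: ler_sum => a _; rewrite -mulrA ler_wpM2l ?(prob_ge0 _ Ig)//.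
by rewrite -addSnnS IHk// ?leqW//; exact: inv_step.
Qed.

(** Before time [n] nothing is known of [V], but [stay] is then an average of its
    values at the next time. *)
Lemma stay_small t g : inv t g ->
  forall e : R, 0 < e -> \forall k \near \oo, stay k t g <= e.
Proof.
move: {2}(n - t)%N (leqnn (n - t)) => j; elim: j t g => [|j IHj] t g.
  rewrite leqn0 subn_eq0 => lent Ig e e0.
  have : \forall k \near \oo, (`|V t g| + 1) / e <= bnd (t + k)%N.
    have /cvgryPge/(_ ((`|V t g| + 1) / e)) := bnd_cvg.
    by move=> [K _ HK]; exists K => // k /= Kk; apply: HK => /=; exact: leq_trans (leq_addl _ _).
  apply: filterS => k lek.
  have V0 : 0 < `|V t g| + 1 by rewrite ltr_pwDr.
  have b0 : 0 < bnd (t + k)%N by apply: lt_le_trans lek; rewrite divr_gt0.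
  rewrite -(ler_pM2r b0); apply: (le_trans (stay_bnd k lent Ig)).
  rewrite ler_pdivrMr// mulrC in lek; apply: le_trans lek.
  by rewrite (le_trans (ler_norm _))// lerDl.
move=> ltj Ig e e0; have [lent|ltnt] := leqP n t.
  by apply: IHj => //; lia.
have small : \forall k \near \oo, forall a : outcome m g, stay k t.+1 (outcome_graph a) <= e.
  apply: filter_forall => a; apply: IHj => //; first by lia.
  exact: inv_step.
have [K _ HK] := small; exists K.+1 => // -[//|k] /= Kk.
case: ifP => _; last exact: ltW.
apply: (@le_trans _ _ (step_mean g (fun=> e))).
  apply: le_step_mean => a; first exact: prob_ge0 Ig.
  exact: HK.
by rewrite /step_mean -mulr_suml (prob_sum1 Ig) mul1r.
Qed.

(** By optional stopping, the probability of staying until time [t] is at most of order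
    [1 / bnd t]. As it need not be measurable, it is shown to be negligible. *)
Theorem drift_negligible :
  P.-negligible [set w | forall t, (n <= t)%N -> A t (G t w)].
Proof.
pose h0 : nat -> graph N := fun=> G0.
have H0 : history 0 h0 = setT.
  apply/seteqP; split => // w _ s; rewrite leqn0 => /eqP ->.
  exact: (attachment_initial process).
have /choice[E HE] := fun k => @cover_stay k 0%N h0 inv0.
exists (\bigcap_k E k); split.
- by apply: bigcapT_measurable => k; have [] := HE k.
- apply/eqP; rewrite eq_le measure_ge0 andbT; apply/lee_addgt0Pr => e e0.
  have [K _ /(_ K (leqnn _)) HK] := stay_small inv0 e0; rewrite add0e.
  have [mE _ leE] := HE K.
  apply: (@le_trans _ _ (P (E K))).
    apply: le_measure; rewrite ?inE//; last exact: bigcap_inf.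
    by apply: bigcapT_measurable => k; have [] := HE k.
  by apply: (le_trans leE); rewrite H0 probability_setT mul1e lee_fin.
- move=> w Aw k _; have [_ subE _] := HE k; apply: subE; split; first by rewrite H0.
  by move=> s _; have [|/Aw] := ltnP s n; [left|right].
Qed.

End Drift.

(** * One step of the cyclic model *)

Section EdgeEnds.
Implicit Types (g : graph 3) (q : pred ('I_3 * bool)).

Definition label g (v : nat) : 'I_3 * bool := nth (ord0, false) (vertices g) v.

(** Counting by edges rather than by vertices makes the effect of a new vertex a
    concatenation of lists. *)
Definition ends g q : nat :=
  (\sum_(e <- edges g) (q (label g e.1) + q (label g e.2)))%N.

Definition comm_ends g i := ends g (fun l => l.1 == i).

Definition red_ends g i := ends g (fun l => l.2 && (l.1 == i)).

Definition valid g :=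
  forall e, e \in edges g -> (e.1 < nb_vertices g)%N /\ (e.2 < nb_vertices g)%N.

Lemma tnth_label g (v : 'I_(nb_vertices g)) :
  tnth (in_tuple (vertices g)) v = label g v.
Proof. by rewrite (tnth_nth (ord0, false)). Qed.

(** Each edge is seen once from each of its ends. *)
Lemma sum_degE g q : valid g ->
  (\sum_(v < nb_vertices g | q (label g v)) deg g v)%N = ends g q.
Proof.
move=> vg; have sum1 x : (x < nb_vertices g)%N ->
    (\sum_(v < nb_vertices g | q (label g v)) (x == v))%N = q (label g x).
  move=> ltx; rewrite big_mkcond (bigD1 (Ordinal ltx))//= eqxx big1 ?addn0.
    by case: (q _).
  move=> v /eqP vx; case: ifP => // _; apply/eqP; rewrite eqb0.
  by apply: contra_notN vx => /eqP xv; exact/val_inj.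
rewrite exchange_big /ends big_seq [RHS]big_seq; apply: eq_bigr => e /vg[e1 e2].
by rewrite big_split/= !sum1.
Qed.

Lemma sum_comm_ends g : (\sum_i comm_ends g i = 2 * size (edges g))%N.
Proof.
rewrite exchange_big/= (eq_bigr (fun=> 2%N)); last first.
  move=> e _; rewrite big_split/=.
  have sum1 (j : 'I_3) : (\sum_(i < 3) (j == i) = 1)%N.
    by rewrite (bigD1 j)//= eqxx big1// => i /negPf; rewrite eq_sym => ->.
  by rewrite !sum1.
by rewrite big_const_seq count_predT iter_addn addn0.
Qed.

Lemma red_ends_le g i : (red_ends g i <= comm_ends g i)%N.
Proof. by apply: leq_sum => e _; apply: leq_add; case: (label g _).2; rewrite ?leq0n. Qed.

Lemma valid_add_vertex g c us b : valid g -> all (gtn (nb_vertices g)) us ->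
  valid (add_vertex g c us b).
Proof.
move=> vg /allP usg e; rewrite /nb_vertices size_rcons mem_cat => /orP[/vg[e1 e2]|].
  by split; exact: leqW.
by move=> /mapP[u /usg /= ltu ->] /=; split; rewrite ltnS// ltnW.
Qed.

Lemma ends_add_vertex g c us b q : valid g -> all (gtn (nb_vertices g)) us ->
  ends (add_vertex g c us b) q =
  (ends g q + size us * q (c, b) + count (fun u => q (label g u)) us)%N.
Proof.
move=> vg usg; have labelE v : (v < nb_vertices g)%N ->
    label (add_vertex g c us b) v = label g v.
  by move=> ltv; rewrite /label nth_rcons -/(nb_vertices g) ltv.
have label_new : label (add_vertex g c us b) (nb_vertices g) = (c, b).
  by rewrite /label nth_rcons ltnn eqxx.
rewrite /ends big_cat/= -addnA; congr (_ + _)%N.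
  by rewrite big_seq [RHS]big_seq; apply: eq_bigr => e /vg[e1 e2]; rewrite !labelE.
rewrite big_map/= big_split/= label_new.
rewrite big_const_seq count_predT iter_addn addn0 mulnC; congr (_ + _)%N.
rewrite -sum1_count [RHS]big_mkcond/= big_seq [RHS]big_seq.
by apply: eq_bigr => u /(allP usg) ltu; rewrite labelE//; case: (q _).
Qed.

End EdgeEnds.

Section TupleSum.
Variables (R : realType) (I : finType).

Lemma sum_tuple_cons k (F : k.+1.-tuple I -> R) :
  \sum_us F us = \sum_u \sum_(us : k.-tuple I) F (cons_tuple u us).
Proof.
rewrite pair_big/= (reindex (fun v : I * k.-tuple I => cons_tuple v.1 v.2))//.
exists (fun us => (thead us, behead_tuple us)) => [[u us] _|us _] /=.
  by congr (_, _); apply/val_inj.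
by rewrite [RHS]tuple_eta; apply/val_inj.
Qed.

(** Independent draws of which only the colour is recorded are Bernoulli trials. *)
Lemma sum_tuple_bin_mean (w : I -> R) (r : pred I) k (phi : nat -> R) :
  \sum_u w u = 1 ->
  \sum_(us : k.-tuple I) (\prod_(u <- us) w u) * phi (count r us) =
  bin_mean k (\sum_(u | r u) w u) phi.
Proof.
move=> w1; elim: k phi => [|k IHk] phi /=.
  rewrite (big_pred1 [tuple]) => [|us]; last by apply/esym/eqP; exact: tuple0.
  by rewrite big_nil mul1r.
rewrite sum_tuple_cons bin_meanS.
have wN : 1 - \sum_(u | r u) w u = \sum_(u | ~~ r u) w u.
  by rewrite -w1 (bigID r)/= addrC addrK.
rewrite (bigID r)/= wN !mulr_suml.
congr (_ + _); apply: eq_bigr => u ru; rewrite -IHk mulr_sumr; apply: eq_bigr => us _.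
  by rewrite big_cons ru mulrA.
by rewrite big_cons (negPf ru) mulrA.
Qed.

End TupleSum.

Section CyclicModel.
Variables (R : realType) (n n0 : nat).
Local Notation m := n.*2.+1.
Local Notation mu := (@uniform_communities R).
Local Notation alpha := (cyclic_attractiveness R).
Local Notation p := (minority_rule R m).

(** The only community in which a newcomer of community [c] finds neighbours. *)
Definition prev (c : 'I_3) : 'I_3 := ord_pred c.

Lemma cyclic_attractivenessE x c : alpha x c = (x == prev c)%:R.
Proof.
by case: x => [[|[|[|x]]] ltx]//; case: c => [[|[|[|c]]] ltc]//; rewrite mxE.
Qed.

(** Preserved by every outcome of a step, whatever its probability. The last clause
    makes the total number of edge-ends a function of time. *)
Definition inv (t : nat) (g : graph 3) : Prop :=
  [/\ valid g, forall i, (0 < comm_ends g i)%N & size (edges g) = (m * (n0 + t))%N].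

Lemma outcome_lt (g : graph 3) (a : outcome m g) : all (gtn (nb_vertices g)) (map val a.1.2).
Proof. by apply/allP => _ /mapP[u _ ->]; exact: (valP u). Qed.

Lemma inv_step t (g : graph 3) (a : outcome m g) : inv t g -> inv t.+1 (outcome_graph a).
Proof.
move=> [vg g0 sz]; have lta := outcome_lt a; split.
- exact: valid_add_vertex.
- by move=> i; rewrite /comm_ends ends_add_vertex// -addnA ltn_addr// g0.
- by rewrite size_cat !size_map size_tuple sz [(n0 + t.+1)%N]addnS mulnS addnC.
Qed.

Definition red_share (g : graph 3) i : R := (red_ends g i)%:R / (comm_ends g i)%:R.

Lemma red_proportionE g i : valid g -> red_proportion g R i = red_share g i.
Proof.
move=> vg; rewrite /red_proportion /red_share /red_ends /comm_ends -!sum_degE//.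
by congr (_%:R / _%:R); apply: eq_bigl => v; rewrite /red /community !tnth_label.
Qed.

(** This holds for every graph, as [0 / 0 = 0]. *)
Lemma red_proportion_itv (g : graph 3) i : 0 <= red_proportion g R i <= 1.
Proof.
rewrite /red_proportion; set a := (\sum_(v < _ | _ && _) _)%N.
set b := (\sum_(v < _ | _) _)%N; have ab : (a <= b)%N.
  rewrite /a /b big_mkcond [in leqRHS]big_mkcond; apply: leq_sum => v _.
  by case: (red v); case: (_ == _).
rewrite divr_ge0//=; have [->|b0] := posnP b; first by rewrite invr0 mulr0.
by rewrite ler_pdivrMr ?ltr0n// mul1r ler_nat.
Qed.

Lemma red_share_itv t g i : inv t g -> 0 <= red_share g i <= 1.
Proof.
move=> [_ g0 _]; rewrite divr_ge0//= ler_pdivrMr ?ltr0n// mul1r ler_nat.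
exact: red_ends_le.
Qed.

Lemma choice_probE t g c (v : 'I_(nb_vertices g)) : inv t g ->
  choice_prob alpha c v =
  ((label g v).1 == prev c)%:R * (deg g v)%:R / (comm_ends g (prev c))%:R.
Proof.
move=> [vg _ _]; rewrite /choice_prob cyclic_attractivenessE /community tnth_label.
congr (_ / _); rewrite /comm_ends -sum_degE// natr_sum [RHS]big_mkcond/=.
apply: eq_bigr => u _; rewrite cyclic_attractivenessE /community tnth_label.
by case: eqP => _; rewrite ?mul1r ?mul0r.
Qed.

Lemma sum_choice_prob t g c (q : pred ('I_3 * bool)) : inv t g ->
  \sum_(v < nb_vertices g | q (label g v)) choice_prob alpha c v =
  (ends g (fun l => q l && (l.1 == prev c)))%:R / (comm_ends g (prev c))%:R.
Proof.
move=> Ig; rewrite (eq_bigr _ (fun v _ => choice_probE c v Ig)) -mulr_suml.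
congr (_ / _); have [vg _ _] := Ig; rewrite -sum_degE// natr_sum big_mkcondr/=.
by apply: eq_bigr => v _; case: eqP => _; rewrite ?mul1r ?mul0r.
Qed.

Lemma sum_choice_prob1 t g c : inv t g ->
  \sum_(v < nb_vertices g) choice_prob alpha c v = 1.
Proof.
move=> Ig; have [_ g0 _] := Ig; rewrite (sum_choice_prob c predT Ig) divff//.
by rewrite pnatr_eq0 -lt0n g0.
Qed.

Lemma sum_choice_prob_red t g c : inv t g ->
  \sum_(v < nb_vertices g | red v) choice_prob alpha c v = red_share g (prev c).
Proof.
move=> Ig; apply: etrans (sum_choice_prob c (fun l => l.2) Ig).
by apply: eq_bigl => v; rewrite /red tnth_label.
Qed.

Lemma choice_prob_ge0 t g c (v : 'I_(nb_vertices g)) : inv t g ->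
  0 <= choice_prob alpha c v.
Proof. by move=> Ig; rewrite (choice_probE c v Ig) divr_ge0 ?mulr_ge0. Qed.

Lemma outcome_prob_ge0 t (g : graph 3) (a : outcome m g) : inv t g ->
  0 <= outcome_prob mu alpha p a.
Proof.
move=> Ig; rewrite /outcome_prob /step_prob mulr_ge0//; last first.
  by rewrite /colour_prob minority_ruleE; case: a.2; case: leqP; rewrite ?subrr ?subr0.
rewrite mulr_ge0 ?prodr_ge0// => [|u _]; last exact: choice_prob_ge0 Ig.
by rewrite invr_ge0.
Qed.

(** Neighbours outside [prev c] have probability zero, so that only the number
    of red neighbours matters, and it is binomial. *)
Lemma step_meanE t g (Phi : graph 3 -> R) (Psi : 'I_3 -> nat -> R) : inv t g ->
  (forall (c : 'I_3) (us : m.-tuple 'I_(nb_vertices g)),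
     all (fun u : 'I_(nb_vertices g) => (label g u).1 == prev c) us ->
     let k := count (@red 3 g) us in
     Phi (add_vertex g c (map val us) (k <= n)%N) = Psi c k) ->
  step_mean m mu alpha p g Phi =
  3^-1 * \sum_c bin_mean m (red_share g (prev c)) (Psi c).
Proof.
move=> Ig PhiE; rewrite /step_mean mulr_sumr.
transitivity (\sum_c \sum_(us : m.-tuple 'I_(nb_vertices g)) \sum_(b : bool)
  step_prob mu alpha p c us b * Phi (add_vertex g c (map val us) b)).
  by rewrite !pair_bigA.
apply: eq_bigr => c _.
rewrite -(sum_choice_prob_red c Ig) -sum_tuple_bin_mean; last exact: sum_choice_prob1 Ig.
rewrite mulr_sumr; apply: eq_bigr => us _.
rewrite big_bool/= /step_prob /colour_prob minority_ruleE /uniform_communities.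
have [usc|/allPn[u uus uc]] :=
    boolP (all (fun u : 'I_(nb_vertices g) => (label g u).1 == prev c) us); last first.
  rewrite (_ : \prod_(u <- us) _ = 0) ?(mulr0, mul0r, addr0)//.
  apply/eqP; rewrite prodf_seq_eq0; apply/hasP; exists u => //=.
  by rewrite (choice_probE c u Ig) (negPf uc) !mul0r.
rewrite -(PhiE c us usc)/=.
by case: (count _ _ <= n)%N; rewrite ?subrr ?subr0 mulr0 mul0r ?addr0 ?add0r mulr1 mulrA.
Qed.

Lemma outcome_prob_sum1 t g : inv t g -> \sum_(a : outcome m g) outcome_prob mu alpha p a = 1.
Proof.
move=> Ig; have := @step_meanE t g (fun=> 1) (fun _ _ => 1) Ig (fun _ _ _ => erefl).
rewrite /step_mean => sumE; rewrite -[LHS]mulr1 mulr_suml sumE.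
under eq_bigr do rewrite bin_mean_cst.
by rewrite sumr_const card_ord -[_ *+ _]mulr_natl mulr1 mulVf.
Qed.

Lemma step_mean_addr t g Phi (a : R) : inv t g ->
  step_mean m mu alpha p g (fun x => Phi x + a) = step_mean m mu alpha p g Phi + a.
Proof.
move=> Ig; rewrite /step_mean; under eq_bigr do rewrite mulrDr.
by rewrite big_split/= -mulr_suml (outcome_prob_sum1 Ig) mul1r.
Qed.

Lemma comm_ends_add t g c (us : m.-tuple 'I_(nb_vertices g)) b i : inv t g ->
  all (fun u : 'I_(nb_vertices g) => (label g u).1 == prev c) us ->
  comm_ends (add_vertex g c (map val us) b) i =
  (comm_ends g i + m * (c == i) + m * (prev c == i))%N.
Proof.
move=> [vg _ _] /allP usc; rewrite /comm_ends ends_add_vertex//; last first.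
  by apply/allP => _ /mapP[u _ ->]; exact: (valP u).
rewrite size_map size_tuple count_map; congr (_ + _)%N.
case: eqP => [<-|/eqP ci].
  rewrite muln1 -[RHS](size_tuple us); apply/eqP; rewrite -all_count.
  exact/allP.
rewrite muln0; apply/eqP; rewrite -leqn0 leqNgt -has_count; apply/hasPn => u /usc /=.
by move=> /eqP->.
Qed.

Lemma red_ends_add t g c (us : m.-tuple 'I_(nb_vertices g)) b i : inv t g ->
  all (fun u : 'I_(nb_vertices g) => (label g u).1 == prev c) us ->
  red_ends (add_vertex g c (map val us) b) i =
  (red_ends g i + m * (b && (c == i)) + count (@red 3 g) us * (prev c == i))%N.
Proof.
move=> [vg _ _] /allP usc; rewrite /red_ends ends_add_vertex//; last first.
  by apply/allP => _ /mapP[u _ ->]; exact: (valP u).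
rewrite size_map size_tuple count_map; congr (_ + _)%N.
case: eqP => [<-|/eqP ci].
  rewrite muln1; apply: eq_in_count => u /usc /= ->.
  by rewrite andbT /red tnth_label.
rewrite muln0; apply/eqP; rewrite -leqn0 leqNgt -has_count; apply/hasPn => u /usc /=.
by move=> /eqP->; rewrite (negPf ci) andbF.
Qed.

Lemma comm_ends_le t g i : inv t g ->
  (comm_ends g i)%:R <= 2 * m%:R * (n0 + t)%:R :> R.
Proof.
move=> [_ _ sz]; rewrite -!natrM ler_nat -mulnA -sz -sum_comm_ends.
by rewrite (bigD1 i)//= leq_addr.
Qed.

End CyclicModel.

Lemma initial_inv n (g : graph 3) : initial_graph g n.*2.+1 ->
  inv n (nb_vertices g) 0 g.
Proof.
move=> [vg sz deg0 comm]; split=> //; last by rewrite addn0.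
move=> i; have [v <-] := comm i.
rewrite /comm_ends -sum_degE// (bigD1 v)/=; last by rewrite /community tnth_label.
by rewrite ltn_addr ?deg0.
Qed.

(** * Second-order bounds for the logarithm *)

Section LogBound.
Variable R : realType.

(** The second-order Taylor coefficient [1/2] is increased to absorb the remainder. That
    it can be taken arbitrarily close to [1/2] is essential, for the noise terms of
    order two cancel exactly later on. *)
Lemma ln1D_lb (th x : R) : 0 <= th <= 1/2 -> `|x| <= th ->
  x - (1/2 + th) * x ^+ 2 <= ln (1 + x).
Proof.
move=> /andP[th0 th1] xth.
(* The derivative of [g] has the sign of its argument on [[- th, th]]. *)
pose g (y : R) := ln (1 + y) - y + (1/2 + th) * y ^+ 2.
pose dg (y : R) := (1 + y)^-1 - 1 + (1 + 2 * th) * y.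
suff: 0 <= g x by rewrite /g; lra.
have Dg (y : R) : `|y| <= th -> is_derive y 1 g (dg y).
  rewrite ler_norml => /andP[y1 y2].
  have y0 : 0 < 1 + y by lra.
  have Did : is_derive y 1 (fun z : R => z) 1 by exact: is_derive_id.
  have Dshift : is_derive y 1 (fun z : R => 1 + z) 1.
    by apply: (is_derive_eq (is_deriveD (is_derive_cst (1 : R) y 1) Did)); rewrite add0r.
  have Dln : is_derive y 1 (fun z : R => ln (1 + z)) ((1 + y)^-1).
    by apply: (is_derive_eq (is_derive1_comp (is_derive1_ln y0) Dshift)); rewrite mulr1.
  have Dsqr : is_derive y 1 (fun z : R => (1/2 + th) * z ^+ 2) ((1/2 + th) * (y + y)).
    apply: (is_derive_eq (is_deriveM (is_derive_cst (1/2 + th) y 1) (is_deriveM Did Did))).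
    by rewrite /GRing.scale/= mulr0 addr0 !mulr1.
  apply: (is_derive_eq (is_deriveD (is_deriveB Dln Did) Dsqr)).
  by rewrite /dg; field; rewrite gt_eqF.
have g0 : g 0 = 0 by rewrite /g addr0 ln1; ring.
have sgn (c : R) : `|c| <= th -> exists2 k, 0 <= k & dg c = k * c.
  rewrite ler_norml => /andP[c1 c2]; have c0 : 0 < 1 + c by lra.
  exists ((c + 2 * th * (1 + c)) / (1 + c)); last by rewrite /dg; field; lra.
  rewrite divr_ge0 ?(ltW c0)//.
  by have : 0 <= th * (1 - 2 * th) + 2 * th * (th + c); [rewrite addr_ge0 ?mulr_ge0//; lra|lra].
have Cg (a b : R) : (forall y, a <= y <= b -> `|y| <= th) -> {within `[a, b], continuous g}.
  move=> ab; apply: derivable_within_continuous => y yab.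
  apply: (@ex_derive _ _ _ _ _ _ _ (Dg y _)); apply: ab.
  by move: yab; rewrite in_itv.
have [x0|x0] := leP 0 x.
  have sub (y : R) : 0 <= y <= x -> `|y| <= th.
    by move=> /andP[y0 yx]; rewrite ger0_norm// (le_trans yx)// (le_trans (ler_norm _)).
  have [||c] := @MVT_segment _ g dg 0 x x0; last 1 first.
  - rewrite in_itv/= => c0x; have [k k0 ->] := sgn _ (sub _ c0x).
    by rewrite g0 !subr0 => ->; case/andP: c0x => c0 _; rewrite !mulr_ge0.
  - by move=> y; rewrite in_itv/= => /andP[y0 yx]; apply/Dg/sub; rewrite !ltW.
  - exact: Cg.
have sub (y : R) : x <= y <= 0 -> `|y| <= th.
  move=> /andP[yx y0]; rewrite ler0_norm// (le_trans _ xth)//.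
  by rewrite (ler0_norm (ltW x0)) lerN2.
have [||c] := @MVT_segment _ g dg x 0 (ltW x0); last 1 first.
- rewrite in_itv/= => c0x; have [k k0 ->] := sgn _ (sub _ c0x).
  rewrite g0 !sub0r mulrN => /oppr_inj ->; case/andP: c0x => _ c0.
  by rewrite -mulrA mulr_ge0// mulr_le0// ltW.
- by move=> y; rewrite in_itv/= => /andP[y0 yx]; apply/Dg/sub; rewrite !ltW.
- exact: Cg.
Qed.

(** Second-order lower bound for the logarithm of a quantity that moves from
    [W] to [W + l + p]; the two parts of the increment are separated in the
    quadratic term because only the mean of [l ^+ 2] is estimated sharply later on. *)
Lemma ln_step_lb (th W l p B : R) : 0 < th <= 1/2 -> 0 < W -> 0 <= p <= B ->
  2 * (l ^+ 2 + B ^+ 2) <= th ^+ 2 * W ^+ 2 ->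
  ln W + (l + p) / W
    - (1/2 + th) * ((1 + th) * l ^+ 2 + (1 + th^-1) * B ^+ 2) / W ^+ 2
  <= ln (W + l + p).
Proof.
move=> /andP[th0 th1] W0 /andP[p0 pB] small.
have pB2 : p ^+ 2 <= B ^+ 2 by rewrite lerXn2r ?nnegrE// (le_trans p0).
have W2 : 0 < W ^+ 2 by rewrite exprn_gt0.
set X := (l + p) / W.
have X2 : X ^+ 2 * W ^+ 2 = (l + p) ^+ 2 by rewrite /X; field; rewrite gt_eqF.
have Xth : `|X| <= th.
  rewrite -(ler_pXn2r (n := 2))// ?nnegrE ?(ltW th0)// real_normK ?num_real//.
  rewrite -(ler_pM2r W2) X2; apply: le_trans small.
  by have := sqr_ge0 (l - p); lra.
have WE : W + l + p = W * (1 + X) by rewrite /X; field; rewrite gt_eqF.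
have X1 : 0 < 1 + X by move: Xth; rewrite ler_norml => /andP[]; lra.
rewrite WE lnM ?posrE// -addrA lerD2l.
apply: le_trans (ln1D_lb _ Xth); last by rewrite (ltW th0).
rewrite lerD2l lerN2 -mulrA ler_wpM2l//; first by lra.
rewrite ler_pdivlMr ?exprn_gt0// X2.
have : 0 <= (th * l - p) ^+ 2 / th by rewrite divr_ge0 ?sqr_ge0// ltW.
have -> : (th * l - p) ^+ 2 / th = th * l ^+ 2 - 2 * l * p + th^-1 * p ^+ 2.
  by field; rewrite gt_eqF.
have : (1 + th^-1) * p ^+ 2 <= (1 + th^-1) * B ^+ 2.
  by rewrite ler_wpM2l// addr_ge0// invr_ge0 ltW.
by lra.
Qed.

End LogBound.

(** * Growth of a rotating and expanding planar walk *)

Section OneStep.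
Variable R : realType.

Let mul3_le (d a x b : R) : `|x| <= d -> - (d * ((a ^+ 2 + b ^+ 2) / 2)) <= a * x * b.
Proof.
move=> xd; have d0 : 0 <= d by exact: le_trans xd.
rewrite lerNl; apply: (le_trans (ler_norm _)); rewrite normrN !normrM mulrAC mulrC.
apply: ler_pM; rewrite ?mulr_ge0//.
have := sqr_ge0 (`|a| - `|b|); have := real_normK (num_real a).
by have := real_normK (num_real b); lra.
Qed.

(** The coordinates rotate, so that the linearized drift stretches the
    quadratic form by [2 + s]; imbalances [D] between community sizes only enter
    multiplied by the small deviations [x]. *)
Lemma drift_lb (Y0 Y1 Y2 D0 D1 D2 x0 x1 x2 h0 h1 h2 e s d rho : R) :
  let Q := Y0 ^+ 2 + Y1 ^+ 2 + Y2 ^+ 2 - Y0 * Y1 - Y1 * Y2 - Y2 * Y0 in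
  let F := D0 ^+ 2 + D1 ^+ 2 + D2 ^+ 2 in
  let L0 := 2 * Y0 - Y1 - Y2 in
  let L1 := 2 * Y1 - Y2 - Y0 in
  let L2 := 2 * Y2 - Y0 - Y1 in
  0 <= e -> 0 <= s -> d <= 1 -> 0 <= rho ->
  `|x0| <= d -> `|x1| <= d -> `|x2| <= d ->
  e * x0 = Y0 - x0 * D0 -> e * x1 = Y1 - x1 * D1 -> e * x2 = Y2 - x2 * D2 ->
  `|h0 - h2| <= rho * `|x0 - x2| -> `|h1 - h2| <= rho * `|x1 - x2| ->
  (2 + s) * Q - (3 * (1 + s) * d + 14 * rho) * (Q + F) <=
  e * (L0 * x0 + L1 * x1 + L2 * x2 +
       (L0 * (h2 - s * x2) + L1 * (h0 - s * x0) + L2 * (h1 - s * x1))).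
Proof.
move=> Q F L0 L1 L2 e0 s0 d1 rho0 xd0 xd1 xd2 E0 E1 E2 H02 H12.
have d0 : 0 <= d by exact: le_trans xd0.
have Q2 : (Y0 - Y1) ^+ 2 + (Y1 - Y2) ^+ 2 + (Y2 - Y0) ^+ 2 = 2 * Q by rewrite /Q; ring.
have L6 : L0 ^+ 2 + L1 ^+ 2 + L2 ^+ 2 = 6 * Q by rewrite /L0 /L1 /L2 /Q; ring.
have F0 : 0 <= F by rewrite !addr_ge0 ?sqr_ge0.
(* As [L0 + L1 + L2 = 0], only differences of the [h] enter, and these are small even
   where the [x] are large compared with their differences. *)
have split : e * (L0 * x0 + L1 * x1 + L2 * x2 +
      (L0 * (h2 - s * x2) + L1 * (h0 - s * x0) + L2 * (h1 - s * x1)))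
  = (2 + s) * Q - (L0 * x0 * D0 + L1 * x1 * D1 + L2 * x2 * D2)
    + s * (L0 * x2 * D2 + L1 * x0 * D0 + L2 * x1 * D1)
    + (L1 * (e * (h0 - h2)) + L2 * (e * (h1 - h2))).
  transitivity (L0 * (e * x0) + L1 * (e * x1) + L2 * (e * x2)
    - s * (L0 * (e * x2) + L1 * (e * x0) + L2 * (e * x1))
    + (L1 * (e * (h0 - h2)) + L2 * (e * (h1 - h2)))).
    by rewrite /L0 /L1 /L2; ring.
  by rewrite E0 E1 E2 /L0 /L1 /L2 /Q; ring.
have T0 : - (d * (3 * Q + F / 2)) <= - (L0 * x0 * D0 + L1 * x1 * D1 + L2 * x2 * D2).
  have := mul3_le (- L0) D0 xd0; have := mul3_le (- L1) D1 xd1.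
  have := mul3_le (- L2) D2 xd2; rewrite !sqrrN.
  have -> : d * (3 * Q + F / 2) =
    d * ((L0 ^+ 2 + D0 ^+ 2) / 2) + d * ((L1 ^+ 2 + D1 ^+ 2) / 2)
    + d * ((L2 ^+ 2 + D2 ^+ 2) / 2).
    by rewrite -!mulrDr; congr (_ * _); rewrite /F; lra.
  by lra.
have T1 : - (d * (3 * Q + F / 2)) <= L0 * x2 * D2 + L1 * x0 * D0 + L2 * x1 * D1.
  have := mul3_le L0 D2 xd2; have := mul3_le L1 D0 xd0; have := mul3_le L2 D1 xd1.
  have -> : d * (3 * Q + F / 2) =
    d * ((L0 ^+ 2 + D2 ^+ 2) / 2) + d * ((L1 ^+ 2 + D0 ^+ 2) / 2)
    + d * ((L2 ^+ 2 + D1 ^+ 2) / 2).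
    by rewrite -!mulrDr; congr (_ * _); rewrite /F; lra.
  by lra.
have T2 (L Ya Yb Da Db xa xb ha hb : R) : `|xa| <= d -> `|xb| <= d ->
    e * xa = Ya - xa * Da -> e * xb = Yb - xb * Db ->
    `|ha - hb| <= rho * `|xa - xb| ->
    L ^+ 2 <= 4 * Q -> (Ya - Yb) ^+ 2 <= 2 * Q -> Da ^+ 2 + Db ^+ 2 <= F ->
    - (rho * (7 * Q + F / 2)) <= L * (e * (ha - hb)).
  move=> xa_d xb_d Ea Eb hab L4 Y2' DF.
  rewrite lerNl; apply: (le_trans (ler_norm _)); rewrite normrN !normrM.
  have habe : `|e| * `|ha - hb| <= rho * (`|Ya - Yb| + `|Da| + `|Db|).
    apply: (@le_trans _ _ (rho * `|e * (xa - xb)|)).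
      by rewrite normrM mulrCA ler_wpM2l.
    apply: ler_wpM2l => //; rewrite mulrBr Ea Eb.
    have -> : Ya - xa * Da - (Yb - xb * Db) = (Ya - Yb) + (- (xa * Da)) + xb * Db by ring.
    apply: (le_trans (ler_normD _ _)); apply: lerD.
      apply: (le_trans (ler_normD _ _)); rewrite lerD2l normrN normrM.
      by rewrite ler_piMl// (le_trans xa_d).
    by rewrite normrM ler_piMl// (le_trans xb_d).
  apply: (@le_trans _ _ (rho * (`|L| * (`|Ya - Yb| + `|Da| + `|Db|)))).
    by rewrite [leRHS]mulrCA ler_wpM2l.
  apply: ler_wpM2l => //.
  have nL := real_normK (num_real L); have nY := real_normK (num_real (Ya - Yb)).
  have na := real_normK (num_real Da); have nb := real_normK (num_real Db).
  have := sqr_ge0 (`|L| - `|Ya - Yb|); have := sqr_ge0 (`|L| - `|Da|).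
  have := sqr_ge0 (`|L| - `|Db|); have -> : `|L| * (`|Ya - Yb| + `|Da| + `|Db|) =
    `|L| * `|Ya - Yb| + `|L| * `|Da| + `|L| * `|Db| by ring.
  rewrite !sqrrB; rewrite nL nY na nb; lra.
have L14 : L1 ^+ 2 <= 4 * Q.
  have := sqr_ge0 (Y2 - Y0); have -> : 4 * Q = L1 ^+ 2 + 3 * (Y2 - Y0) ^+ 2; last by lra.
  by rewrite /Q /L1; ring.
have L24 : L2 ^+ 2 <= 4 * Q.
  have := sqr_ge0 (Y0 - Y1); have -> : 4 * Q = L2 ^+ 2 + 3 * (Y0 - Y1) ^+ 2; last by lra.
  by rewrite /Q /L2; ring.
have := sqr_ge0 (Y0 - Y1); have := sqr_ge0 (Y1 - Y2); have := sqr_ge0 (Y2 - Y0).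
have := sqr_ge0 D0; have := sqr_ge0 D1; have := sqr_ge0 D2 => D22 D12 D02 Y20 Y12 Y01.
have Q0 : 0 <= Q by lra.
have T3 := T2 L1 _ _ _ _ _ _ h0 h2 xd0 xd2 E0 E2 H02 L14 _ _.
have T4 := T2 L2 _ _ _ _ _ _ h1 h2 xd1 xd2 E1 E2 H12 L24 _ _.
have {}T3 : - (rho * (7 * Q + F / 2)) <= L1 * (e * (h0 - h2)).
  by apply: T3; [rewrite -sqrrN opprB; lra|rewrite /F; lra].
have {}T4 : - (rho * (7 * Q + F / 2)) <= L2 * (e * (h1 - h2)).
  by apply: T4; [lra|rewrite /F; lra].
have {}T1 := ler_wpM2l s0 T1.
rewrite split.
have : 0 <= d * F by rewrite mulr_ge0.
have : 0 <= s * (d * F) by rewrite !mulr_ge0.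
have : 0 <= rho * F by rewrite mulr_ge0.
lra.
Qed.

(** Isotropy: averaged over the three communities, the squared linear part of
    the increment sees the noise through the one number [a + b - h], which is also
    the mean of its quadratic part. *)
Lemma noise_ub (Y0 Y1 Y2 a b h b0 b1 b2 h0 h1 h2 k : R) :
  let Q := Y0 ^+ 2 + Y1 ^+ 2 + Y2 ^+ 2 - Y0 * Y1 - Y1 * Y2 - Y2 * Y0 in
  let L0 := 2 * Y0 - Y1 - Y2 in
  let L1 := 2 * Y1 - Y2 - Y0 in
  let L2 := 2 * Y2 - Y0 - Y1 in
  `|b0 - b| <= k -> `|b1 - b| <= k -> `|b2 - b| <= k ->
  `|h0 - h| <= k -> `|h1 - h| <= k -> `|h2 - h| <= k ->
  (a * L0 ^+ 2 + 2 * (L0 * L2 * h2) + b2 * L2 ^+ 2)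
  + (a * L1 ^+ 2 + 2 * (L1 * L0 * h0) + b0 * L0 ^+ 2)
  + (a * L2 ^+ 2 + 2 * (L2 * L1 * h1) + b1 * L1 ^+ 2)
  <= 6 * (a + b - h) * Q + 18 * k * Q.
Proof.
move=> Q L0 L1 L2 B0 B1 B2 H0 H1 H2.
have k0 : 0 <= k by exact: le_trans B0.
have hb (u v w : R) : `|w - h| <= k ->
    2 * (u * v * w) <= 2 * (u * v * h) + k * (u ^+ 2 + v ^+ 2).
  move=> wk; have := mul3_le (- u) v wk; rewrite sqrrN; lra.
have bb (u w : R) : `|w - b| <= k -> w * u ^+ 2 <= b * u ^+ 2 + k * u ^+ 2.
  move=> wk; rewrite -mulrDl ler_wpM2r ?sqr_ge0//.
  by move: wk; rewrite ler_norml => /andP[]; lra.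
apply: (@le_trans _ _ (a * L0 ^+ 2 + (2 * (L0 * L2 * h) + k * (L0 ^+ 2 + L2 ^+ 2))
     + (b * L2 ^+ 2 + k * L2 ^+ 2)
  + (a * L1 ^+ 2 + (2 * (L1 * L0 * h) + k * (L1 ^+ 2 + L0 ^+ 2))
     + (b * L0 ^+ 2 + k * L0 ^+ 2))
  + (a * L2 ^+ 2 + (2 * (L2 * L1 * h) + k * (L2 ^+ 2 + L1 ^+ 2))
     + (b * L1 ^+ 2 + k * L1 ^+ 2)))).
  by rewrite !lerD// ?hb// ?bb.
by rewrite le_eqVlt; apply/orP/or_introl/eqP; rewrite /Q /L0 /L1 /L2; ring.
Qed.

(** The expected logarithmic growth exceeds [2 / t]: where [Q] dominates [M * t]
    because of the expansion rate, where [Q] is small because of the noise, and in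
    between because the gain and the loss due to isotropic noise cancel. *)
Lemma log_growth_lb (Q F t M q eta ep K S1 Pb S2 : R) :
  let W := Q + M * t in
  0 <= Q -> 0 <= F -> 0 < t -> 0 < M -> 0 <= q -> 0 < eta -> 0 < ep <= 1/2 -> 0 <= K ->
  M + 12 * eta * (1 + 3 * eta) * M <= 12 * eta * q ->
  ep * (M + 4 * q + 3) <= eta * M ->
  K <= eta * t * M ^+ 2 ->
  (2 + 6 * eta) * Q - ep * (Q + F) <= t * S1 ->
  q - ep <= Pb ->
  S2 <= (2 * q + ep) * Q ->
  (2 + eta) / t - ep * F / (M * t ^+ 2) <=
  (S1 + Pb + M) / W - (1/2 + ep) * ((1 + ep) * S2 + K) / W ^+ 2.
Proof.
move=> W Q0 F0 t0 M0 q0 eta0 /andP[ep0 ep1] K0 Mq epM Kt S1b Pbb S2b.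
have Mt0 : 0 < M * t by rewrite mulr_gt0.
have W0 : 0 < W by rewrite /W; lra.
have core : (2 + 3 * eta) * W ^+ 2 <=
    ((2 + 6 * eta) * Q + (q + M) * t) * W - t * q * Q.
  have sq : 0 <= (6 * eta * Q - M * t) ^+ 2 by exact: sqr_ge0.
  (* The difference of the two sides is a quadratic polynomial in [Q], multiplied by
     [12 * eta] in order to complete the square. *)
  have c0 : 0 <= t ^+ 2 * M * (12 * eta * q - (M + 12 * eta * (1 + 3 * eta) * M)).
    by apply: mulr_ge0; [rewrite mulr_ge0 ?sqr_ge0 ?(ltW M0)|rewrite subr_ge0].
  have eta12 : 0 < 12 * eta by rewrite mulr_gt0.
  rewrite -subr_ge0 -(pmulr_rge0 _ eta12).
  have -> : 12 * eta * (((2 + 6 * eta) * Q + (q + M) * t) * W - t * q * Q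
       - (2 + 3 * eta) * W ^+ 2) = (6 * eta * Q - M * t) ^+ 2
     + t ^+ 2 * M * (12 * eta * q - (M + 12 * eta * (1 + 3 * eta) * M)).
    by rewrite /W; ring.
  by rewrite addr_ge0.
set X := (S1 + Pb + M) * W * t - t * ((1/2 + ep) * ((1 + ep) * S2 + K)).
have XE : (S1 + Pb + M) / W - (1/2 + ep) * ((1 + ep) * S2 + K) / W ^+ 2
    = X / (t * W ^+ 2).
  by rewrite /X; field; rewrite !gt_eqF.
rewrite XE ler_pdivlMr ?mulr_gt0 ?exprn_gt0//.
have -> : ((2 + eta) / t - ep * F / (M * t ^+ 2)) * (t * W ^+ 2)
   = (2 + eta) * W ^+ 2 - ep * F * (W * (W / (M * t))).
  by field; rewrite !gt_eqF.
have WMt : 1 <= W / (M * t) by rewrite ler_pdivlMr// mul1r /W lerDr.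
have FW : ep * F * W <= ep * F * (W * (W / (M * t))).
  by rewrite ler_wpM2l ?mulr_ge0 ?(ltW ep0)// ler_peMr// ltW.
have S2b' : (1/2 + ep) * ((1 + ep) * S2 + K) <= q * Q + ep * (4 * q + 2) * Q + K.
  have A1 : (1/2 + ep) * ((1 + ep) * S2) <= (1/2 + 2 * ep) * ((2 * q + ep) * Q).
    apply: (@le_trans _ _ ((1/2 + ep) * ((1 + ep) * ((2 * q + ep) * Q)))).
      by rewrite ler_wpM2l ?ler_wpM2l//; lra.
    have A0 : 0 <= ep * (1/2 - ep) by apply: mulr_ge0; lra.
    by rewrite !mulrA ler_wpM2r// ler_wpM2r//; lra.
  have A2 : (1/2 + 2 * ep) * ((2 * q + ep) * Q) <= q * Q + ep * (4 * q + 2) * Q.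
    have A0 : 0 <= ep * (3/2 - 2 * ep) by apply: mulr_ge0; lra.
    by rewrite mulrA -mulrDl ler_wpM2r//; lra.
  have A3 : (1/2 + ep) * K <= K by rewrite ler_piMl//; lra.
  by rewrite mulrDr; lra.
have {S2b'}S2b' := ler_wpM2l (ltW t0) S2b'.
have S1b' : ((2 + 6 * eta) * Q - ep * (Q + F) + (q - ep + M) * t) * W
    <= (S1 + Pb + M) * W * t.
  rewrite [leRHS]mulrAC ler_wpM2r ?(ltW W0)//.
  have : (q - ep) * t <= Pb * t by rewrite ler_wpM2r// ltW.
  by lra.
have W2 : W ^+ 2 = W * W by rewrite expr2.
have E1 : ep * Q * W <= ep * W ^+ 2.
  by rewrite W2 mulrA ler_wpM2r ?(ltW W0)// ler_wpM2l ?(ltW ep0)// /W lerDl ltW.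
have tW : t * M <= W by rewrite /W mulrC lerDr.
have E2 : M * (ep * t * W) <= ep * W ^+ 2.
  have -> : M * (ep * t * W) = ep * (t * M * W) by ring.
  by rewrite W2 ler_wpM2l ?(ltW ep0)// ler_wpM2r// ltW.
have QW : Q <= W by rewrite /W lerDl ltW.
have E3 : M * (t * (ep * (4 * q + 2) * Q)) <= ep * (4 * q + 2) * W ^+ 2.
  have -> : M * (t * (ep * (4 * q + 2) * Q)) = ep * (4 * q + 2) * (t * M * Q) by ring.
  rewrite W2 ler_wpM2l//; first by rewrite mulr_ge0 ?(ltW ep0)//; lra.
  by apply: ler_pM => //; rewrite mulrC ltW.
have E4 : t * K <= eta * W ^+ 2.
  apply: (@le_trans _ _ (eta * (t * M) ^+ 2)).
    have := ler_wpM2l (ltW t0) Kt; rewrite (_ : t * (eta * t * _) = eta * (t * M) ^+ 2)//.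
    by ring.
  by rewrite ler_wpM2l ?(ltW eta0)// lerXn2r// nnegrE ltW// mulrC.
have E5 : ep * W ^+ 2 + ep * t * W + t * (ep * (4 * q + 2) * Q) <= eta * W ^+ 2.
  rewrite -(ler_pM2l M0).
  have := ler_wpM2r (sqr_ge0 W) epM.
  by lra.
by rewrite /X; lra.
Qed.

(** The mean growth of [F] is spread over the time [t], while its division by a larger
    time saves enough to pay for the error term of [log_growth_lb]. *)
Lemma imbalance_growth_ub (F T M ep eta v : R) :
  0 <= F -> 1 <= T -> 0 < M -> 0 < ep -> 0 <= v -> 8 * ep * v <= 3 * (eta * M) ->
  2 * ep / M * (F + 2 * v / 3) / (T + 1) <=
  2 * ep / M * F / T + eta / 2 / T - ep * F / (M * T ^+ 2).
Proof.
move=> F0 t1 M0 ep0 v0 cm; have t0 : 0 < T by lra.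
have T1 : 0 < T + 1 by lra.
have epM0 : 0 < 2 * ep / M by rewrite divr_gt0 ?mulr_gt0.
have gain : 2 * ep / M * (2 * v / 3) / (T + 1) <= eta / 2 / T.
  apply: ler_pM; rewrite ?invr_ge0 ?(ltW T1)//.
  - by apply: mulr_ge0; [exact: ltW|rewrite divr_ge0// mulr_ge0].
  - rewrite -(ler_pM2r M0).
    have -> : 2 * ep / M * (2 * v / 3) * M = 4 / 3 * (ep * v).
      by field; rewrite gt_eqF.
    by lra.
  - by rewrite lef_pV2 ?posrE//; lra.
have loss : ep * F / (M * T ^+ 2) <= 2 * ep / M * F / T - 2 * ep / M * F / (T + 1).
  have -> : 2 * ep / M * F / T - 2 * ep / M * F / (T + 1)
      = ep * F / (M * T ^+ 2) * (2 * T / (T + 1)).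
    by field; rewrite !gt_eqF.
  rewrite ler_peMr//.
    by apply: divr_ge0; apply: mulr_ge0; rewrite ?sqr_ge0// ltW.
  by rewrite ler_pdivlMr//; lra.
have -> : 2 * ep / M * (F + 2 * v / 3) / (T + 1) =
  2 * ep / M * F / (T + 1) + 2 * ep / M * (2 * v / 3) / (T + 1) by ring.
by lra.
Qed.

End OneStep.

(** * Moments of the noise of one step *)

Section NoiseMoments.
Variables (R : realType) (n : nat).
Local Notation m := n.*2.+1.
Local Notation mR := (m%:R : R).

(** Contribution of a step to the red excess of the community of the newcomer,
    when [k] of its neighbours are red. *)
Definition xi k : R := if (k <= n)%N then mR / 2 else - (mR / 2).

(** Contribution to the red excess of the community of the neighbours. *)
Definition ka k : R := k%:R - mR / 2.

Definition kaka z : R := bin_mean m z (fun k => ka k ^+ 2).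

Definition xika z : R := bin_mean m z (fun k => xi k * ka k).

(** The mean of [xi ^+ 2 + ka ^+ 2 - xi * ka], the quadratic form of the plane orthogonal
    to the diagonal evaluated at the increment of one step. *)
Definition spread z : R := (mR / 2) ^+ 2 + kaka z - xika z.

Lemma xi_sqr k : xi k ^+ 2 = (mR / 2) ^+ 2.
Proof. by rewrite /xi; case: ifP; rewrite ?sqrrN. Qed.

Lemma ka_sqr_le k : (k <= m)%N -> ka k ^+ 2 <= (mR / 2) ^+ 2.
Proof.
move=> lekm; have : 0 <= k%:R * (mR - k%:R) by rewrite mulr_ge0// subr_ge0 ler_nat.
by rewrite /ka; lra.
Qed.

Lemma bin_mean_noise z c0 c1 c2 c3 c4 :
  bin_mean m z (fun k => c0 + c1 * xi k + c2 * ka k + c3 * ka k ^+ 2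
                         + c4 * (xi k * ka k)) =
  c0 + c1 * (mR * (red_prob n z - 1/2)) + c2 * (mR * (z - 1/2))
  + c3 * kaka z + c4 * xika z.
Proof.
rewrite !bin_meanD !bin_meanZ bin_mean_cst; congr (_ + _ * _ + _ * _ + _ + _).
  transitivity (bin_mean m z (fun k => mR * minority_rule R m k - mR / 2)).
    apply: eq_bin_mean => k _; rewrite minority_ruleE /xi.
    by case: ifP => _ /=; [lra|rewrite mulr0 sub0r].
  by rewrite bin_meanB bin_meanZ bin_mean_cst /red_prob; lra.
by rewrite /ka bin_meanB bin_mean_cst bin_mean_id; lra.
Qed.

Lemma kaka_near z : 0 <= z <= 1 ->
  `|kaka z - kaka (1/2)| <= 2 * mR * mR ^+ 2 * `|z - 1/2|.
Proof.
move=> z01; apply: bin_mean_lipschitz => //; last by lra.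
move=> k /ka_sqr_le lek; rewrite ger0_norm ?sqr_ge0// (le_trans lek)//.
by have := sqr_ge0 mR; lra.
Qed.

Lemma xika_near z : 0 <= z <= 1 ->
  `|xika z - xika (1/2)| <= 2 * mR * mR ^+ 2 * `|z - 1/2|.
Proof.
move=> z01; apply: bin_mean_lipschitz => //; last by lra.
move=> k /ka_sqr_le lek; rewrite ler_norml; have := sqr_ge0 mR; have := xi_sqr k.
have := sqr_ge0 (xi k - ka k); have := sqr_ge0 (xi k + ka k).
by move=> *; apply/andP; split; lra.
Qed.

Lemma noise_quad_itv k : (k <= m)%N ->
  0 <= xi k ^+ 2 + ka k ^+ 2 - xi k * ka k <= mR ^+ 2.
Proof.
move=> /ka_sqr_le lek; have := sqr_ge0 mR; have := xi_sqr k.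
have := sqr_ge0 (xi k - ka k); have := sqr_ge0 (xi k + ka k).
by move=> *; apply/andP; split; lra.
Qed.

(** The quadratic form is at least [3/4 * xi ^+ 2], and [xi ^+ 2] is constant: the noise
    does not degenerate at the equilibrium. *)
Lemma spread_gt0 : 0 < spread (1/2).
Proof.
have m2 : 0 < mR ^+ 2 by rewrite exprn_gt0.
apply: (@lt_le_trans _ _ (3/16 * mR ^+ 2)); first by lra.
rewrite /spread.
have half01 : 0 <= (1 : R) / 2 <= 1 by lra.
have := @le_bin_mean _ m (1/2) (fun=> 3/16 * mR ^+ 2) (fun k => (mR / 2) ^+ 2
  + 0 * xi k + 0 * ka k + 1 * ka k ^+ 2 + (-1) * (xi k * ka k)) half01.
rewrite bin_mean_cst bin_mean_noise => H.
suff /H : forall k, (k <= m)%N -> 3/16 * mR ^+ 2 <= (mR / 2) ^+ 2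
  + 0 * xi k + 0 * ka k + 1 * ka k ^+ 2 + (-1) * (xi k * ka k) by lra.
by move=> k lekm; have := sqr_ge0 (xi k / 2 - ka k); have := xi_sqr k; lra.
Qed.

(** The lower bound for the logarithm is affine in [xi], [ka], [ka ^+ 2] and [xi * ka],
    whose means are known. *)
Lemma log_mean_lb z W l l' M th : 0 <= z <= 1 -> 0 < th <= 1/2 -> 0 < W -> 0 <= M ->
  2 * (mR ^+ 2 * (l ^+ 2 + l' ^+ 2) + (mR ^+ 2 + M) ^+ 2) <= th ^+ 2 * W ^+ 2 ->
  ln W + (l * (mR * (red_prob n z - 1/2)) + l' * (mR * (z - 1/2)) + spread z + M) / W
  - (1/2 + th) * ((1 + th) * ((mR / 2) ^+ 2 * l ^+ 2 + 2 * (l * l' * xika z)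
                              + kaka z * l' ^+ 2)
                  + (1 + th^-1) * (mR ^+ 2 + M) ^+ 2) / W ^+ 2
  <= bin_mean m z (fun k => ln (W + (xi k * l + ka k * l')
                              + (xi k ^+ 2 + ka k ^+ 2 - xi k * ka k + M))).
Proof.
move=> z01 th01 W0 M0 small.
pose a := (1/2 + th) / W ^+ 2.
apply: (@le_trans _ _ (bin_mean m z (fun k =>
    (ln W + ((mR / 2) ^+ 2 + M) / W
      - a * ((1 + th) * (mR / 2) ^+ 2 * l ^+ 2 + (1 + th^-1) * (mR ^+ 2 + M) ^+ 2))
    + (l / W) * xi k + (l' / W) * ka k
    + (W^-1 - a * (1 + th) * l' ^+ 2) * ka k ^+ 2
    + (- W^-1 - a * (1 + th) * (2 * l * l')) * (xi k * ka k)))).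
  by rewrite bin_mean_noise /a /spread le_eqVlt; apply/orP/or_introl/eqP; ring.
apply: le_bin_mean => // k lekm.
have /andP[p0 p1] := noise_quad_itv lekm.
have := @ln_step_lb _ th W (xi k * l + ka k * l')
  (xi k ^+ 2 + ka k ^+ 2 - xi k * ka k + M) (mR ^+ 2 + M) th01 W0.
have -> : 0 <= xi k ^+ 2 + ka k ^+ 2 - xi k * ka k + M <= mR ^+ 2 + M.
  by rewrite addr_ge0//= lerD2r.
move=> /(_ isT) H; apply: le_trans (H _); last first.
  apply: le_trans small; rewrite ler_wpM2l// lerD2r.
  have : (xi k * l + ka k * l') ^+ 2 <= 2 * (xi k ^+ 2 * l ^+ 2 + ka k ^+ 2 * l' ^+ 2).
    by have := sqr_ge0 (xi k * l - ka k * l'); lra.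
  rewrite xi_sqr; have := ler_wpM2r (sqr_ge0 l') (ka_sqr_le lekm).
  have := mulr_ge0 (sqr_ge0 mR) (sqr_ge0 l); have := mulr_ge0 (sqr_ge0 mR) (sqr_ge0 l').
  by lra.
have xs := xi_sqr k; have W1 : W != 0 by rewrite gt_eqF.
have th1 : th != 0 by case/andP: th01 => th0 _; rewrite gt_eqF.
rewrite le_eqVlt; apply/orP/or_introl/eqP.
rewrite /a -xs; field.
by rewrite W1.
Qed.

End NoiseMoments.

(** * Limits are equilibria *)

Section Harmonic.
Variable R : realType.

Lemma ln_succ_le (x : R) : 0 < x -> ln (x + 1) - ln x <= x^-1.
Proof.
move=> x0; rewrite -ln_div ?posrE ?addr_gt0//.
have -> : (x + 1) / x = 1 + x^-1 by rewrite mulrDl divff ?gt_eqF// mul1r.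
by apply: le_ln1Dx; apply: lt_trans (_ : 0 < _); rewrite ?ltrN10 ?invr_gt0.
Qed.

Lemma cvg_ln_time (c : R) n0 : 0 < c -> (fun t => c * ln (n0 + t)%:R) @ \oo --> +oo.
Proof.
move=> c0; apply/cvgryPge => A.
have [K _ HK] := @nbhs_infty_ger R (expR (A / c)); exists K => // t /= /HK le_t.
rewrite mulrC -ler_pdivrMr// -[leLHS]expRK ler_ln ?posrE ?expR_gt0//.
  by rewrite (le_trans le_t)// ler_nat leq_addl.
by rewrite (lt_le_trans (expR_gt0 _) (le_trans le_t _))// ler_nat leq_addl.
Qed.

End Harmonic.

Local Notation o0 := (@Ordinal 3 0 isT).
Local Notation o1 := (@Ordinal 3 1 isT).
Local Notation o2 := (@Ordinal 3 2 isT).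

Section Cycle.
Implicit Types i c : 'I_3.

Lemma prev_ordS i : prev (ordS i) = i.
Proof. by apply/val_inj; case: i => [[|[|[|]]]]. Qed.

Lemma ordS_neq i : (ordS i == i) = false.
Proof. by apply/negP => /eqP/(congr1 val); case: i => [[|[|[|]]]]. Qed.

Lemma prev_neq i : (prev i == i) = false.
Proof. by apply/negP => /eqP/(congr1 val); case: i => [[|[|[|]]]]. Qed.

Lemma prev_prev_neq i : (prev (prev i) == i) = false.
Proof. by apply/negP => /eqP/(congr1 val); case: i => [[|[|[|]]]]. Qed.

Lemma sum_cycle (V : nmodType) (F : 'I_3 -> V) i :
  \sum_c F c = F i + F (ordS i) + F (prev i).
Proof.
rewrite (bigD1 i)//= (bigD1 (ordS i)) ?ordS_neq//= (bigD1 (prev i))/=; last first.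
  rewrite prev_neq/=; apply/negP => /eqP/(congr1 val).
  by case: i => [[|[|[|]]]].
rewrite big1 ?addr0 ?addrA// => j /andP[/andP[/eqP j1 /eqP j2] /eqP j3]; exfalso.
case: i j j1 j2 j3 => [[|[|[|i]]] lti]// [[|[|[|j]]] ltj]// j1 j2 j3;
  by [apply: j1; apply: val_inj|apply: j2; apply: val_inj|apply: j3; apply: val_inj].
Qed.

Lemma ord3P (Pr : 'I_3 -> Prop) : Pr o0 -> Pr o1 -> Pr o2 -> forall c, Pr c.
Proof.
move=> P0 P1 P2 [[|[|[|c]]] ltc]//.
- by rewrite (_ : Ordinal ltc = o0)//; apply/val_inj.
- by rewrite (_ : Ordinal ltc = o1)//; apply/val_inj.
- by rewrite (_ : Ordinal ltc = o2)//; apply/val_inj.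
Qed.

Lemma prev0 : prev o0 = o2. Proof. exact/val_inj. Qed.
Lemma prev1 : prev o1 = o0. Proof. exact/val_inj. Qed.
Lemma prev2 : prev o2 = o1. Proof. exact/val_inj. Qed.

Lemma sum3 (V : nmodType) (F : 'I_3 -> V) : \sum_c F c = F o0 + F o1 + F o2.
Proof. rewrite (sum_cycle _ o0) (_ : ordS o0 = o1) ?prev0//; exact/val_inj. Qed.

End Cycle.

Section NonEquilibrium.
Variables (R : realType) (n : nat) (G0 : graph 3).
Local Notation m := n.*2.+1.
Local Notation mu := (@uniform_communities R).
Local Notation alpha := (cyclic_attractiveness R).
Local Notation p := (minority_rule R m).
Local Notation n0 := (nb_vertices G0).
Local Notation inv := (inv n n0).

(** Choosing neighbours in community [i] does not change the mean proportion there; only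
    the colour of a newcomer of community [i] does. *)
Lemma step_mean_red_share t g i (a b : R) : inv t g ->
  step_mean m mu alpha p g (fun g' => a + b * red_share R g' i) =
  a + b * (red_share R g i + m%:R / 3 * (red_prob n (red_share R g (prev i)) - red_share R g i)
                     / ((comm_ends g i)%:R + m%:R)).
Proof.
move=> Ig; have [_ g0 _] := Ig; have := g0 i.
rewrite (step_meanE (Psi := fun c k => a + b * ((red_ends g i
  + m * ((k <= n)%N && (c == i)) + k * (prev c == i))%:R /
  (comm_ends g i + m * (c == i) + m * (prev c == i))%:R)) Ig); last first.
  move=> c us usc /=; rewrite /red_share (red_ends_add _ _ Ig usc) (comm_ends_add _ _ Ig usc).
  by [].
rewrite (sum_cycle _ i) /= prev_ordS eqxx ordS_neq prev_neq prev_prev_neq.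
set E := comm_ends g i; set r := red_ends g i => E0.
have ER : E%:R != 0 :> R by rewrite pnatr_eq0 -lt0n.
have EmR : E%:R + m%:R != 0 :> R by rewrite -natrD pnatr_eq0 addnS.
have zE : red_share R g i = r%:R / E%:R by [].
set z := red_share R g (prev i); set z' := red_share R g (prev (prev i)).
have newcomer : bin_mean m z (fun k => a + b * ((r + m * ((k <= n)%N && true)
    + k * false)%:R / (E + m * true + m * false)%:R))
    = a + b * (r%:R + m%:R * red_prob n z) / (E%:R + m%:R).
  transitivity (bin_mean m z (fun k => (a + b * r%:R / (E%:R + m%:R))
      + b * m%:R / (E%:R + m%:R) * minority_rule R m k)).
    apply: eq_bin_mean => k _; rewrite minority_ruleE andbT !muln0 !addn0 muln1.
    by rewrite !natrD natrM; field.
  by rewrite bin_meanD bin_mean_cst bin_meanZ -/(red_prob n z); field.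
have neighbour : bin_mean m (red_share R g i) (fun k => a + b * ((r + m * ((k <= n)%N && false)
    + k * true)%:R / (E + m * false + m * true)%:R))
    = a + b * (r%:R + m%:R * red_share R g i) / (E%:R + m%:R).
  transitivity (bin_mean m (red_share R g i) (fun k => (a + b * r%:R / (E%:R + m%:R))
      + b / (E%:R + m%:R) * k%:R)).
    apply: eq_bin_mean => k _; rewrite andbF !muln0 !addn0 !muln1.
    by rewrite !natrD; field.
  by rewrite bin_meanD bin_mean_cst bin_meanZ bin_mean_id; field.
have bystander : bin_mean m z' (fun k => a + b * ((r + m * ((k <= n)%N && false)
    + k * false)%:R / (E + m * false + m * false)%:R)) = a + b * (r%:R / E%:R).
  transitivity (bin_mean m z' (fun=> a + b * (r%:R / E%:R))); last exact: bin_mean_cst.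
  by apply: eq_bin_mean => k _; rewrite andbF !muln0 !addn0.
rewrite newcomer neighbour bystander zE.
by move: (m%:R : R) EmR => M EmR; field; rewrite EmR ER.
Qed.

Hypothesis n0_gt0 : (0 < n0)%N.

(** A signed deviation [s * (red_prob (Z (prev i)) - Z i)] bounded below makes
    [s * Z i] grow like a harmonic series, although it is bounded. *)
Lemma off_equilibrium_negligible (d : measure_display) (T : measurableType d)
    (P : probability T R) (G : nat -> T -> graph 3) i (s e : R) T0 :
  attachment_process m mu alpha p G0 P G -> initial_graph G0 m ->
  `|s| <= 1 -> 0 < e ->
  P.-negligible [set w | forall t, (T0 <= t)%N ->
    e <= s * (red_prob n (red_proportion (G t w) R (prev i))
              - red_proportion (G t w) R i)].
Proof.
move=> process init s1 e0.
have n0t t : 0 < (n0 + t)%:R :> R by rewrite ltr0n addn_gt0 n0_gt0.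
have sz t g : inv t g -> s * red_share R g i <= 1.
  move=> Ig; have /andP[z0 z1] := red_share_itv R i Ig.
  apply: (le_trans (ler_norm _)); rewrite normrM (ger0_norm z0).
  by rewrite mulr_ile1.
(* A community has at most [2 * m * t] edge-ends, so that the denominator
   [3 * (E + m)] of the mean increment is at most [9 * m * t]. *)
have e9 : 0 < e / 9 by rewrite divr_gt0.
apply: (@drift_negligible _ _ _ mu alpha p G0 _ _ P G process inv _ _ _ _
  (fun t g => e <= s * (red_prob n (red_proportion g R (prev i))
                        - red_proportion g R i)) T0
  (fun t g => (1 + e / 9 * ln (n0 + t)%:R) + (- s) * red_share R g i)
  (fun t => e / 9 * ln (n0 + t)%:R)).
- exact: initial_inv.
- by move=> t g a; exact: inv_step.
- by move=> t g a; exact: outcome_prob_ge0.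
- by move=> t g; exact: outcome_prob_sum1.
- by move=> t _; rewrite mulr_ge0 ?(ltW e9)// ln_ge0// ler1n addn_gt0 n0_gt0.
- by move=> t g _ /sz; lra.
- move=> t g _ Ig /= drift; have [vg _ _] := Ig.
  rewrite !red_proportionE// in drift; rewrite (step_mean_red_share _ _ _ Ig).
  set E := (comm_ends g i)%:R; set D := red_prob n _ - _ in drift *.
  have E0 : 0 < E by have [_ g0 _] := Ig; rewrite ltr0n g0.
  have Et : E <= 2 * m%:R * (n0 + t)%:R := comm_ends_le R i Ig.
  have m1 : 1 <= m%:R :> R by rewrite ler1n.
  have t1 : 1 <= (n0 + t)%:R :> R by rewrite ler1n addn_gt0 n0_gt0.
  have mt : m%:R <= m%:R * (n0 + t)%:R :> R by rewrite ler_peMr.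
  have step : e / 9 * ((n0 + t)%:R)^-1 <= s * (m%:R / 3 * D / (E + m%:R)).
    have -> : s * (m%:R / 3 * D / (E + m%:R)) = m%:R / 3 * (s * D) / (E + m%:R) by ring.
    rewrite ler_pdivlMr ?addr_gt0// ?ltr0n//.
    apply: (@le_trans _ _ (m%:R / 3 * e)); last first.
      by rewrite ler_wpM2l// divr_ge0.
    have -> : e / 9 / (n0 + t)%:R * (E + m%:R) = e / 9 * ((E + m%:R) / (n0 + t)%:R).
      by rewrite mulrAC -mulrA.
    have -> : m%:R / 3 * e = e / 9 * (3 * m%:R) by field.
    by rewrite ler_wpM2l ?(ltW e9)// ler_pdivrMr//; lra.
  have : e / 9 * (ln (n0 + t.+1)%:R - ln (n0 + t)%:R) <= e / 9 * ((n0 + t)%:R)^-1.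
    by rewrite ler_wpM2l ?(ltW e9)// addnS -natr1 ln_succ_le.
  by lra.
- exact: cvg_ln_time.
Qed.

End NonEquilibrium.

(** * The Lyapunov function *)

Section Lyapunov.
Variables (R : realType) (n n0 : nat).
Local Notation m := n.*2.+1.
Local Notation mR := (m%:R : R).
Local Notation mu := (@uniform_communities R).
Local Notation alpha := (cyclic_attractiveness R).
Local Notation p := (minority_rule R m).
Local Notation inv := (inv n n0).
Local Notation tm t := ((n0 + t)%:R : R).

(** This is [3 / 2] times the squared distance to the diagonal. *)
Definition quad (y : 'I_3 -> R) : R :=
  y o0 ^+ 2 + y o1 ^+ 2 + y o2 ^+ 2 - y o0 * y o1 - y o1 * y o2 - y o2 * y o0.

Definition grad (y : 'I_3 -> R) i : R := 3 * y i - \sum_j y j.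

(** The red edge-ends in excess of one half. Unlike the proportions, the excesses of the
    three communities are not divided by three different random numbers. *)
Definition excess (g : graph 3) i : R := (red_ends g i)%:R - (comm_ends g i)%:R / 2.

(** The deviation of the number of edge-ends from its mean growth. *)
Definition imbalance t (g : graph 3) i : R := (comm_ends g i)%:R - 2 * mR * tm t / 3.

(** The logarithm measures the squared distance of the excesses to the diagonal, smoothed
    at the scale [t] of the noise; its coefficient [2 + eta / 2], above the exponent
    [2] of the largest possible growth, makes the function large at large times. The last
    term decreases in mean where the imbalance is large, which is where the imbalance
    disturbs the growth of the logarithm. *)
Definition lyap (eta M beta : R) t g : R :=
  (2 + eta / 2) * ln (tm t) - ln (quad (excess g) + M * tm t)
  + beta * (\sum_i imbalance t g i ^+ 2) / tm t.

Lemma quad_ge0 y : 0 <= quad y.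
Proof.
have -> : quad y = ((y o0 - y o1) ^+ 2 + (y o1 - y o2) ^+ 2 + (y o2 - y o0) ^+ 2) / 2.
  by rewrite /quad; field.
by rewrite divr_ge0// !addr_ge0 ?sqr_ge0.
Qed.

Lemma quad_step (y : 'I_3 -> R) u v c :
  quad (fun i => y i + u * (c == i)%:R + v * (prev c == i)%:R) =
  quad y + (u * grad y c + v * grad y (prev c)) + (u ^+ 2 + v ^+ 2 - u * v).
Proof.
rewrite /quad /grad sum3; elim/ord3P: c; rewrite ?prev0 ?prev1 ?prev2 /=; ring.
Qed.

Lemma grad_sqr_le y c : grad y c ^+ 2 + grad y (prev c) ^+ 2 <= 6 * quad y.
Proof.
have L6 : grad y o0 ^+ 2 + grad y o1 ^+ 2 + grad y o2 ^+ 2 = 6 * quad y.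
  by rewrite /grad !sum3 /quad; ring.
have := sqr_ge0 (grad y o0); have := sqr_ge0 (grad y o1); have := sqr_ge0 (grad y o2).
by elim/ord3P: c; rewrite ?prev0 ?prev1 ?prev2; lra.
Qed.

Lemma sum_imbalance_step (D : 'I_3 -> R) (a : R) :
  \sum_c \sum_i (D i + a * (c == i)%:R + a * (prev c == i)%:R - 2 * a / 3) ^+ 2 =
  3 * \sum_i D i ^+ 2 + 2 * a ^+ 2.
Proof. by rewrite !sum3 prev0 prev1 prev2 /=; field. Qed.

Lemma excess_le t g i : inv t g -> `|excess g i| <= mR * tm t.
Proof.
move=> Ig; have Et := comm_ends_le R i Ig.
have : (red_ends g i)%:R <= (comm_ends g i)%:R :> R by rewrite ler_nat red_ends_le.
have : 0 <= (red_ends g i)%:R :> R by [].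
by rewrite /excess ler_norml => *; apply/andP; split; lra.
Qed.

Lemma quad_excess_le t g : inv t g -> quad (excess g) <= 6 * mR ^+ 2 * tm t ^+ 2.
Proof.
move=> Ig; set B := mR * tm t.
have sq (a b : R) : `|a| <= B -> `|b| <= B -> (a - b) ^+ 2 <= 4 * B ^+ 2.
  move=> aB bB; have B0 : 0 <= B by exact: le_trans aB.
  rewrite -real_normK ?num_real// (_ : 4 * B ^+ 2 = (B + B) ^+ 2); last by ring.
  rewrite lerXn2r ?nnegrE ?addr_ge0//.
  by rewrite (le_trans (ler_normB _ _))// lerD.
have := sq _ _ (excess_le o0 Ig) (excess_le o1 Ig).
have := sq _ _ (excess_le o1 Ig) (excess_le o2 Ig).
have := sq _ _ (excess_le o2 Ig) (excess_le o0 Ig).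
rewrite /quad (_ : 6 * mR ^+ 2 * _ = 6 * B ^+ 2); last by rewrite /B; ring.
by lra.
Qed.

(** The smoothed squared distance is at most of order [t ^+ 2]. *)
Lemma lyap_lb eta M beta t g : 0 < M -> 0 <= beta -> (0 < n0 + t)%N -> inv t g ->
  eta / 2 * ln (tm t) <= lyap eta M beta t g + ln (6 * mR ^+ 2 + M).
Proof.
move=> M0 beta0 t0 Ig.
have tm1 : 1 <= tm t by rewrite ler1n.
have tm0 : 0 < tm t by rewrite ltr0n.
have C0 : 0 < 6 * mR ^+ 2 + M by rewrite ltr_wpDl// mulr_ge0// sqr_ge0.
have F0 : 0 <= beta * (\sum_i imbalance t g i ^+ 2) / tm t.
  by rewrite divr_ge0 ?(ltW tm0)// mulr_ge0// sumr_ge0// => i _; rewrite sqr_ge0.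
have W0 : 0 < quad (excess g) + M * tm t by rewrite ltr_wpDl ?quad_ge0// mulr_gt0.
suff : ln (quad (excess g) + M * tm t) <= 2 * ln (tm t) + ln (6 * mR ^+ 2 + M).
  by rewrite /lyap; lra.
have -> : 2 * ln (tm t) = ln (tm t) + ln (tm t) by ring.
rewrite -!lnM ?posrE ?mulr_gt0// ler_ln ?posrE ?mulr_gt0//.
have := quad_excess_le Ig.
have : M * tm t <= M * tm t * tm t by rewrite ler_peMr// mulr_ge0// ltW.
by lra.
Qed.

Lemma excess_add t g c (us : m.-tuple 'I_(nb_vertices g)) i : inv t g ->
  all (fun u : 'I_(nb_vertices g) => (label g u).1 == prev c) us ->
  let k := count (@red 3 g) us in
  excess (add_vertex g c (map val us) (k <= n)%N) i =
  excess g i + xi R n k * (c == i)%:R + ka R n k * (prev c == i)%:R.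
Proof.
move=> Ig usc /=; rewrite /excess (red_ends_add _ _ Ig usc) (comm_ends_add _ _ Ig usc).
rewrite !natrD !natrM /xi /ka.
by case: (_ <= n)%N; case: (c == i); case: (prev c == i); rewrite /=; lra.
Qed.

Lemma imbalance_add t g c (us : m.-tuple 'I_(nb_vertices g)) b i : inv t g ->
  all (fun u : 'I_(nb_vertices g) => (label g u).1 == prev c) us ->
  imbalance t.+1 (add_vertex g c (map val us) b) i =
  imbalance t g i + mR * (c == i)%:R + mR * (prev c == i)%:R - 2 * mR / 3.
Proof.
move=> Ig usc; rewrite /imbalance (comm_ends_add _ _ Ig usc) !natrD !natrM.
by rewrite -[t.+1%:R]natr1; lra.
Qed.

(** Only the logarithm has a nontrivial mean: the imbalance of the community
    sizes is an unbiased walk. *)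
Lemma step_mean_lyap eta M beta t g : inv t g ->
  step_mean m mu alpha p g (lyap eta M beta t.+1) =
  (2 + eta / 2) * ln (tm t.+1)
  - 3^-1 * \sum_c bin_mean m (red_share R g (prev c)) (fun k =>
      ln (quad (excess g) + M * tm t
          + (xi R n k * grad (excess g) c + ka R n k * grad (excess g) (prev c))
          + (xi R n k ^+ 2 + ka R n k ^+ 2 - xi R n k * ka R n k + M)))
  + beta * (\sum_i imbalance t g i ^+ 2 + 2 * mR ^+ 2 / 3) / tm t.+1.
Proof.
move=> Ig.
pose inc c := \sum_i (imbalance t g i + mR * (c == i)%:R + mR * (prev c == i)%:R
                      - 2 * mR / 3) ^+ 2.
pose lg c k := ln (quad (excess g) + M * tm t
          + (xi R n k * grad (excess g) c + ka R n k * grad (excess g) (prev c))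
          + (xi R n k ^+ 2 + ka R n k ^+ 2 - xi R n k * ka R n k + M)).
rewrite (step_meanE (Psi := fun c k => (2 + eta / 2) * ln (tm t.+1)
   + beta * inc c / tm t.+1 - lg c k) Ig); last first.
  move=> c us usc k; rewrite /lyap /inc /lg.
  rewrite (eq_bigr _ (fun i _ => congr1 (fun x => x ^+ 2) (imbalance_add _ i Ig usc))).
  have -> : excess (add_vertex g c [seq val i | i <- us] (k <= n)%N)
      = (fun i => excess g i + xi R n k * (c == i)%:R + ka R n k * (prev c == i)%:R).
    by apply/funext => i; rewrite (excess_add i Ig usc).
  rewrite quad_step addnS -[in M * _]natr1.
  have -> : forall q a b x : R, q + a + b + M * (x + 1) = q + M * x + a + (b + M).
    by move=> *; ring.
  by rewrite addrAC.
under eq_bigr do rewrite bin_meanB bin_mean_cst.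
rewrite sumrB big_split/= sumr_const card_ord -mulr_suml -mulr_sumr sum_imbalance_step.
rewrite -[_ *+ 3]mulr_natl; have : tm t.+1 != 0 by rewrite pnatr_eq0 addnS.
by move: (tm t.+1) (ln _) => x y x0; field.
Qed.

End Lyapunov.

(** * Its drift near the symmetric equilibrium *)

Section LyapunovStep.
Variables (R : realType) (n n0 : nat).
Local Notation m := n.*2.+1.
Local Notation mR := (m%:R : R).
Local Notation mu := (@uniform_communities R).
Local Notation alpha := (cyclic_attractiveness R).
Local Notation p := (minority_rule R m).
Local Notation inv := (inv n n0).
Local Notation tm t := ((n0 + t)%:R : R).
Local Notation s := (minority_slope R n).
Local Notation q := (spread n (1/2)).
Local Notation kappa := (2 * mR * mR ^+ 2).

(** The hypotheses list what is needed of the constants: [M] is small with respect to the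
    strength [spread] of the noise, then [ep] bounds all relative errors, then [d] is the
    size of the neighbourhood in which these bounds hold, and then [t] is large. *)
Lemma lyap_step (eta M ep d : R) t g :
  s = 2 + 12 * eta -> 0 < eta -> 0 < M -> 0 < ep <= 1/2 -> 0 <= d <= 1/2 ->
  M + 12 * eta * (1 + 3 * eta) * M <= 12 * eta * q ->
  ep * (M + 4 * q + 3) <= eta * M ->
  8 * ep * mR ^+ 2 <= 3 * (eta * M) ->
  (3 * (1 + s) + 28 * n%:R * s + 6 * kappa) * d <= ep ->
  (1 + ep^-1) * (mR ^+ 2 + M) ^+ 2 <= eta * tm t * M ^+ 2 ->
  6 * mR ^+ 2 <= ep ^+ 2 * M * tm t ->
  2 * (mR ^+ 2 + M) ^+ 2 <= ep ^+ 2 * M ^+ 2 * tm t ->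
  1 <= tm t -> inv t g -> (forall i, `|red_share R g i - 1/2| <= d) ->
  step_mean m mu alpha p g (lyap n n0 eta M (2 * ep / M) t.+1) <=
  lyap n n0 eta M (2 * ep / M) t g.
Proof.
move=> sE eta0 M0 /[dup] ep01 /andP[ep0 ep1] d01 cM cq cm cd cK cQ cB t1 Ig near_half.
have /andP[d0 d1] := d01.
have s0 := minority_slope_ge0 R n; have q0 := spread_gt0 R n.
have t0 : 0 < tm t by lra.
have kappa0 : 0 <= kappa by rewrite !mulr_ge0.
rewrite (step_mean_lyap _ _ _ Ig) /lyap.
set Y := excess R g; set F := \sum_i imbalance R n n0 t g i ^+ 2; set Q := quad Y.
set W := Q + M * tm t.
have gradE0 : grad Y o0 = 2 * Y o0 - Y o1 - Y o2 by rewrite /grad sum3; ring.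
have gradE1 : grad Y o1 = 2 * Y o1 - Y o2 - Y o0 by rewrite /grad sum3; ring.
have gradE2 : grad Y o2 = 2 * Y o2 - Y o0 - Y o1 by rewrite /grad sum3; ring.
have F0 : 0 <= F by apply: sumr_ge0 => i _; rewrite sqr_ge0.
have Q0 : 0 <= Q by exact: quad_ge0.
have QF0 : 0 <= Q + F by exact: addr_ge0.
have W0 : 0 < W by rewrite ltr_wpDl// mulr_gt0.
have z01 i : 0 <= red_share R g i <= 1 by exact: (red_share_itv R i Ig).
pose x i := red_share R g i - 1/2.
pose h i := red_prob n (red_share R g i) - 1/2 + s * x i.
have xE i : 2 * mR * tm t / 3 * x i = Y i - x i * imbalance R n n0 t g i.
  have [_ g0 _] := Ig; have E0 : (comm_ends g i)%:R != 0 :> R by rewrite pnatr_eq0 -lt0n.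
  have : x i * (comm_ends g i)%:R = Y i by rewrite /x /Y /red_share /excess; field.
  by rewrite /imbalance; lra.
have hB i j : `|h i - h j| <= 2 * n%:R * s * d * `|x i - x j|.
  have := red_prob_near_half n d01 (near_half i) (near_half j).
  have -> : x i - x j = red_share R g i - red_share R g j by rewrite /x; ring.
  congr (`|_| <= _); rewrite /h /x; ring.
pose S1 := 3^-1 * \sum_c (grad Y c * (mR * (red_prob n (red_share R g (prev c)) - 1/2))
   + grad Y (prev c) * (mR * (red_share R g (prev c) - 1/2))).
pose Pb := 3^-1 * \sum_c spread n (red_share R g (prev c)).
pose S2 := 3^-1 * \sum_c ((mR / 2) ^+ 2 * grad Y c ^+ 2
   + 2 * (grad Y c * grad Y (prev c) * xika n (red_share R g (prev c)))
   + kaka n (red_share R g (prev c)) * grad Y (prev c) ^+ 2).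
have kd : kappa * d <= ep / 6.
  have : 0 <= (3 * (1 + s) + 28 * n%:R * s) * d.
    by rewrite !mulr_ge0// addr_ge0// !mulr_ge0// addr_ge0.
  by lra.
have kk_near i : `|kaka n (red_share R g i) - kaka n (1/2)| <= kappa * d.
  by apply: (le_trans (kaka_near n (z01 i))); rewrite ler_wpM2l.
have xk_near i : `|xika n (red_share R g i) - xika n (1/2)| <= kappa * d.
  by apply: (le_trans (xika_near n (z01 i))); rewrite ler_wpM2l.
have S1_lb : (2 + 6 * eta) * Q - ep * (Q + F) <= tm t * S1.
  have e0 : 0 <= 2 * mR * tm t / 3 by rewrite divr_ge0// !mulr_ge0// ltW.
  have d1' : d <= 1 by lra.
  have rho0 : 0 <= 2 * n%:R * s * d by rewrite !mulr_ge0.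
  have drift := drift_lb e0 s0 d1' rho0 (near_half o0) (near_half o1) (near_half o2)
    (xE _) (xE _) (xE _) (hB _ _) (hB _ _).
  have FE : F = imbalance R n n0 t g o0 ^+ 2 + imbalance R n n0 t g o1 ^+ 2
      + imbalance R n n0 t g o2 ^+ 2 by rewrite /F sum3.
  have S1E : 2 * (tm t * S1) = 2 * mR * tm t / 3 *
    ((2 * Y o0 - Y o1 - Y o2) * (red_share R g o0 - 1/2)
     + (2 * Y o1 - Y o2 - Y o0) * (red_share R g o1 - 1/2)
     + (2 * Y o2 - Y o0 - Y o1) * (red_share R g o2 - 1/2)
     + ((2 * Y o0 - Y o1 - Y o2) * (h o2 - s * (red_share R g o2 - 1/2))
        + (2 * Y o1 - Y o2 - Y o0) * (h o0 - s * (red_share R g o0 - 1/2))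
        + (2 * Y o2 - Y o0 - Y o1) * (h o1 - s * (red_share R g o1 - 1/2)))).
    by rewrite /S1 sum3 prev0 prev1 prev2 /grad !sum3 /h /x; field.
  rewrite -S1E -FE -/(quad Y) -/Q in drift.
  have : (3 * (1 + s) * d + 14 * (2 * n%:R * s * d)) * (Q + F) <= ep * (Q + F).
    have kd0 : 0 <= kappa * d by rewrite mulr_ge0.
    by apply: ler_wpM2r => //; lra.
  have : 0 <= ep * (Q + F) by apply: mulr_ge0 => //; exact: ltW.
  have : s * Q = (2 + 12 * eta) * Q by rewrite -sE.
  by lra.
have spread_lb i : q - ep <= spread n (red_share R g i).
  have := kk_near i; have := xk_near i; rewrite !ler_norml /spread => /andP[_ x2] /andP[k1 _].
  by lra.
have Pb_lb : q - ep <= Pb.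
  rewrite /Pb sum3; have := spread_lb (prev o0); have := spread_lb (prev o1).
  by have := spread_lb (prev o2); lra.
have S2_ub : S2 <= (2 * q + ep) * Q.
  have := noise_ub (Y o0) (Y o1) (Y o2) ((mR / 2) ^+ 2)
    (kk_near o0) (kk_near o1) (kk_near o2) (xk_near o0) (xk_near o1) (xk_near o2).
  rewrite -/(quad Y) -/Q -/q => noise.
  have kQ := ler_wpM2r Q0 kd.
  have S2E : 3 * S2 = ((mR / 2) ^+ 2 * grad Y o0 ^+ 2
      + 2 * (grad Y o0 * grad Y o2 * xika n (red_share R g o2))
      + kaka n (red_share R g o2) * grad Y o2 ^+ 2)
    + ((mR / 2) ^+ 2 * grad Y o1 ^+ 2
      + 2 * (grad Y o1 * grad Y o0 * xika n (red_share R g o0))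
      + kaka n (red_share R g o0) * grad Y o0 ^+ 2)
    + ((mR / 2) ^+ 2 * grad Y o2 ^+ 2
      + 2 * (grad Y o2 * grad Y o1 * xika n (red_share R g o1))
      + kaka n (red_share R g o1) * grad Y o1 ^+ 2).
    by rewrite /S2 sum3 prev0 prev1 prev2; field.
  rewrite -gradE0 -gradE1 -gradE2 -S2E in noise.
  by lra.
have K0 : 0 <= (1 + ep^-1) * (mR ^+ 2 + M) ^+ 2.
  by rewrite mulr_ge0 ?sqr_ge0// addr_ge0// invr_ge0 ltW.
have growth := log_growth_lb Q0 F0 t0 M0 (ltW q0) eta0 ep01 K0 cM cq cK S1_lb Pb_lb S2_ub.
have grad6 c : grad Y c ^+ 2 + grad Y (prev c) ^+ 2 <= 6 * Q.
  exact: grad_sqr_le.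
have small c : 2 * (mR ^+ 2 * (grad Y c ^+ 2 + grad Y (prev c) ^+ 2) + (mR ^+ 2 + M) ^+ 2)
    <= ep ^+ 2 * W ^+ 2.
  have W2 : W ^+ 2 = Q ^+ 2 + 2 * (M * tm t) * Q + M ^+ 2 * tm t ^+ 2 by rewrite /W; ring.
  have T1 := ler_wpM2l (sqr_ge0 mR) (grad6 c).
  have T2 := ler_wpM2r Q0 cQ.
  have T3 : ep ^+ 2 * M ^+ 2 * tm t <= ep ^+ 2 * M ^+ 2 * tm t ^+ 2.
    rewrite [tm t ^+ 2]expr2 [leRHS]mulrA; apply: ler_peMr => //.
    by apply: mulr_ge0; [rewrite mulr_ge0 ?sqr_ge0|exact: ltW].
  have : 0 <= ep ^+ 2 * Q ^+ 2 by rewrite mulr_ge0 ?sqr_ge0.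
  by rewrite W2; lra.
have log_lb : ln W + (2 + eta) / tm t - ep * F / (M * tm t ^+ 2) <=
    3^-1 * \sum_c bin_mean m (red_share R g (prev c)) (fun k =>
      ln (W + (xi R n k * grad Y c + ka R n k * grad Y (prev c))
          + (xi R n k ^+ 2 + ka R n k ^+ 2 - xi R n k * ka R n k + M))).
  set K := (1 + ep^-1) * _ in growth.
  pose LB c := ln W + (grad Y c * (mR * (red_prob n (red_share R g (prev c)) - 1/2))
      + grad Y (prev c) * (mR * (red_share R g (prev c) - 1/2))
      + spread n (red_share R g (prev c)) + M) / W
    - (1/2 + ep) * ((1 + ep) * ((mR / 2) ^+ 2 * grad Y c ^+ 2
      + 2 * (grad Y c * grad Y (prev c) * xika n (red_share R g (prev c)))
      + kaka n (red_share R g (prev c)) * grad Y (prev c) ^+ 2) + K) / W ^+ 2.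
  apply: (@le_trans _ _ (3^-1 * \sum_c LB c)); last first.
    rewrite ler_wpM2l// ?invr_ge0//; apply: ler_sum => c _.
    exact: (log_mean_lb (z01 (prev c)) ep01 W0 (ltW M0) (small c)).
  have -> : 3^-1 * \sum_c LB c
    = ln W + ((S1 + Pb + M) / W - (1/2 + ep) * ((1 + ep) * S2 + K) / W ^+ 2).
    rewrite /LB /S1 /Pb /S2 !sum3; move: (lt0r_neq0 W0).
    by generalize K (ln W) W => K' lw w w0; field.
  by rewrite -addrA lerD2l.
have ln_t : ln (tm t.+1) - ln (tm t) <= (tm t)^-1.
  by rewrite addnS -natr1 ln_succ_le.
have imb_ub : 2 * ep / M * (F + 2 * mR ^+ 2 / 3) / tm t.+1 <=
    2 * ep / M * F / tm t + eta / 2 / tm t - ep * F / (M * tm t ^+ 2).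
  by rewrite addnS -[(n0 + t).+1%:R]natr1 imbalance_growth_ub// ?sqr_ge0.
have eta2 : 0 <= 2 + eta / 2 by lra.
have {}ln_t := ler_wpM2l eta2 ln_t.
by lra.
Qed.

End LyapunovStep.

(** * The symmetric equilibrium is not a limit *)

Section Escape.
Variables (R : realType) (n : nat) (G0 : graph 3).
Local Notation m := n.*2.+1.
Local Notation mR := (m%:R : R).
Local Notation mu := (@uniform_communities R).
Local Notation alpha := (cyclic_attractiveness R).
Local Notation p := (minority_rule R m).
Local Notation n0 := (nb_vertices G0).
Hypothesis n0_gt0 : (0 < n0)%N.

(** The constants are chosen in the order [eta], [M], [ep], [r], and then a time from
    which the remainders of order two are negligible. *)
Lemma near_half_negligible (d : measure_display) (T : measurableType d)
    (P : probability T R) (G : nat -> T -> graph 3) :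
  (3 <= n)%N -> attachment_process m mu alpha p G0 P G -> initial_graph G0 m ->
  exists2 r : R, 0 < r & forall T0, P.-negligible [set w | forall t, (T0 <= t)%N ->
    forall i, `|red_proportion (G t w) R i - 1/2| <= r].
Proof.
move=> n3 process init.
have s2 := minority_slope_gt2 R n3; set s := minority_slope R n in s2.
have q0 := spread_gt0 R n; set q := spread n (1/2) in q0.
(* The expansion rate [1 + s / 2] is [2 + 6 * eta]: completing the square in
   [log_growth_lb] costs [3 * eta] of it, and the error terms cost [2 * eta]. *)
pose eta : R := (s - 2) / 12; have eta0 : 0 < eta by rewrite divr_gt0// subr_gt0.
pose B : R := 1 + 12 * eta * (1 + 3 * eta).
have B0 : 0 < B.
  by apply: addr_gt0 => //; apply: mulr_gt0; [rewrite mulr_gt0|lra].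
(* The largest [M] that the discriminant condition of [log_growth_lb] allows. *)
pose M : R := 12 * eta * q / B.
have M0 : 0 < M by apply: divr_gt0 => //; apply: mulr_gt0 => //; exact: mulr_gt0.
have etaM0 : 0 < eta * M by rewrite mulr_gt0.
have m2 : 0 < mR ^+ 2 by rewrite exprn_gt0.
pose D : R := 2 * (eta * M) + (M + 4 * q + 3) + 3 * mR ^+ 2.
have D0 : 0 < D by rewrite /D; lra.
pose ep : R := eta * M / D; have ep0 : 0 < ep by rewrite divr_gt0.
have epD : ep * D = eta * M by rewrite divfK// gt_eqF.
have ep_le x : x <= D -> ep * x <= eta * M.
  by move=> xD; rewrite -epD ler_wpM2l// ltW.
(* A Lipschitz constant of the second moments of the noise *)
pose kappa : R := 2 * mR * mR ^+ 2.
have kappa0 : 0 <= kappa by rewrite !mulr_ge0.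
pose E : R := 2 * ep + (3 * (1 + s) + 28 * n%:R * s + 6 * kappa).
have ns0 : 0 <= n%:R * s by rewrite mulr_ge0//; lra.
have E0 : 0 < E by rewrite /E; lra.
pose r : R := ep / E; have r0 : 0 < r by rewrite divr_gt0.
have rE : r * E = ep by rewrite divfK// gt_eqF.
have ep_half : ep <= 1/2.
  by rewrite ler_pdivrMr//; rewrite /D; lra.
have r_half : r <= 1/2.
  by rewrite ler_pdivrMr// /E; lra.
pose t1 : R := 1 + (1 + ep^-1) * (mR ^+ 2 + M) ^+ 2 / (eta * M ^+ 2)
  + 6 * mR ^+ 2 / (ep ^+ 2 * M) + 2 * (mR ^+ 2 + M) ^+ 2 / (ep ^+ 2 * M ^+ 2).
have [K _ HK] := @nbhs_infty_ger R t1.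
exists r => // T0.
pose C := ln (6 * mR ^+ 2 + M).
suff : P.-negligible [set w | forall t, (maxn T0 K <= t)%N ->
    forall i, `|red_proportion (G t w) R i - 1/2| <= r].
  by apply: negligibleS => w /= Hw t; rewrite geq_max => /andP[/Hw].
apply: (@drift_negligible _ _ _ mu alpha p G0 _ _ P G process (inv n n0) _ _ _ _
  (fun t g => forall i, `|red_proportion g R i - 1/2| <= r) (maxn T0 K)
  (fun t g => lyap n n0 eta M (2 * ep / M) t g + C)
  (fun t => eta / 2 * ln (n0 + t)%:R)).
- exact: initial_inv.
- by move=> t g a; exact: inv_step.
- by move=> t g a; exact: outcome_prob_ge0.
- by move=> t g; exact: outcome_prob_sum1.
- move=> t _; apply: mulr_ge0; first by rewrite divr_ge0// ltW.
  by rewrite ln_ge0// ler1n addn_gt0 n0_gt0.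
- move=> t g _ Ig; apply: lyap_lb => //; last by rewrite addn_gt0 n0_gt0.
  by rewrite divr_ge0 ?(ltW M0)// mulr_ge0// ltW.
- move=> t g; rewrite geq_max => /andP[_ /HK tK] Ig near.
  have [vg _ _] := Ig; rewrite (step_mean_addr _ _ Ig) lerD2r.
  have tt : t1 <= (n0 + t)%:R by rewrite (le_trans tK)// ler_nat leq_addl.
  have a1 : 0 <= (1 + ep^-1) * (mR ^+ 2 + M) ^+ 2 / (eta * M ^+ 2).
    apply: divr_ge0; first by rewrite mulr_ge0 ?sqr_ge0// addr_ge0// invr_ge0 ltW.
    by rewrite mulr_ge0 ?sqr_ge0// ltW.
  have a2 : 0 <= 6 * mR ^+ 2 / (ep ^+ 2 * M).
    by apply: divr_ge0; rewrite mulr_ge0 ?sqr_ge0// ltW.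
  have a3 : 0 <= 2 * (mR ^+ 2 + M) ^+ 2 / (ep ^+ 2 * M ^+ 2).
    by apply: divr_ge0; rewrite mulr_ge0 ?sqr_ge0.
  have b1 : 0 < eta * M ^+ 2 by rewrite mulr_gt0 ?exprn_gt0.
  have b2 : 0 < ep ^+ 2 * M by rewrite mulr_gt0 ?exprn_gt0.
  have b3 : 0 < ep ^+ 2 * M ^+ 2 by rewrite mulr_gt0 ?exprn_gt0.
  apply: (@lyap_step _ _ _ _ _ _ r) => //.
  + by rewrite -/s /eta; field.
  + by rewrite ep0 ep_half.
  + by rewrite r_half ltW.
  + have -> : M + 12 * eta * (1 + 3 * eta) * M = M * B by rewrite /B; ring.
    by rewrite /M divfK// gt_eqF.
  + by apply: ep_le; rewrite /D -/q; lra.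
  + have := @ep_le (3 * mR ^+ 2); rewrite /D => H.
    have {}H : ep * (3 * mR ^+ 2) <= eta * M by apply: H; lra.
    lra.
  + have : r * (2 * ep) + r * (3 * (1 + s) + 28 * n%:R * s + 6 * kappa) = ep.
      by rewrite -mulrDr -/E rE.
    have : 0 <= r * ep by apply: mulr_ge0; exact: ltW.
    by rewrite -/s -/kappa; lra.
  + have : (1 + ep^-1) * (mR ^+ 2 + M) ^+ 2 / (eta * M ^+ 2) <= (n0 + t)%:R.
      by rewrite /t1 in tt; lra.
    by rewrite ler_pdivrMr// [leRHS]mulrCA [leRHS]mulrA.
  + have : 6 * mR ^+ 2 / (ep ^+ 2 * M) <= (n0 + t)%:R by rewrite /t1 in tt; lra.
    by rewrite ler_pdivrMr// [leRHS]mulrC.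
  + have : 2 * (mR ^+ 2 + M) ^+ 2 / (ep ^+ 2 * M ^+ 2) <= (n0 + t)%:R.
      by rewrite /t1 in tt; lra.
    by rewrite ler_pdivrMr// [leRHS]mulrC.
  + by rewrite /t1 in tt; lra.
  + by move=> i; rewrite -(red_proportionE R i vg).
- by apply: cvg_ln_time; rewrite divr_gt0.
Qed.

End Escape.

Section Equilibrium.
Variables (R : realType) (n : nat).

Lemma continuous_red_prob : continuous (@red_prob R n).
Proof.
move=> z; apply: differentiable_continuous; apply/derivable1_diffP.
exact: (@ex_derive _ _ _ _ _ _ _ (is_derive_bin_mean _ z _)).
Qed.

(** A decreasing map has no cycle of odd length other than its fixed point. *)
Lemma equilibrium_half (l : 'I_3 -> R) : (forall i, 0 <= l i <= 1) ->
  (forall i, red_prob n (l (prev i)) = l i) -> forall i, l i = 1/2.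
Proof.
move=> l01 fl.
have anti i j : l i <= l j -> l (ordS j) <= l (ordS i).
  move=> lij; have /andP[i0 _] := l01 i; have /andP[_ j1] := l01 j.
  by have := red_prob_nincr n i0 lij j1; rewrite -{1}(prev_ordS j) fl -{1}(prev_ordS i) fl.
have cyc (i : 'I_3) : ordS (ordS (ordS i)) = i.
  by apply/val_inj; case: i => [[|[|[|i]]] lti].
have le i : l i <= l (ordS i).
  rewrite leNgt; apply/negP => lt_i.
  have h2 := anti _ _ (anti _ _ (ltW lt_i)); rewrite cyc in h2.
  by have := anti _ _ h2; rewrite cyc leNgt lt_i.
move=> i; have e : l (ordS i) = l i.
  have h1 := le (ordS i); have h2 := le (ordS (ordS i)); rewrite cyc in h2.
  by apply/eqP; rewrite eq_le le andbT (le_trans h1).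
have /andP[i0 i1] := l01 i; have fi := fl (ordS i); rewrite prev_ordS e in fi.
have fhalf := red_prob_half R n.
have [h|h] := leP (l i) (1/2).
  have h1 : (1 : R) / 2 <= 1 by lra.
  by have := red_prob_nincr n i0 h h1; rewrite fi fhalf; lra.
have h0 : 0 <= (1 : R) / 2 by lra.
by have := red_prob_nincr n h0 (ltW h) i1; rewrite fi fhalf; lra.
Qed.

End Equilibrium.

Theorem proposition3p9 (R : realType) (m : nat) (m_odd : odd m) (m_ge7 : (7 <= m)%N)
    (G0 : graph 3) (G0_initial : initial_graph G0 m)
    (d : measure_display) (T : measurableType d) (P : probability T R)
    (G : nat -> T -> graph 3)
    (G_process : attachment_process m (@uniform_communities R)
       (cyclic_attractiveness R) (minority_rule R m) G0 P G) :
  {ae P, forall w,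
     ~ cvg ((\row_(i < 3) red_proportion (G t w) R i) @[t --> \oo])}.
Proof.
have [n mE n3] : exists2 n, m = n.*2.+1 & (3 <= n)%N by exists m./2; lia.
subst m.
have n0_gt0 : (0 < nb_vertices G0)%N.
  by have [_ _ _ /(_ ord0)[v _]] := G0_initial; exact: leq_ltn_trans (ltn_ord v).
pose Z w i t := red_proportion (G t w) R i.
pose dev w i t := red_prob n (Z w (prev i) t) - Z w i t.
have [r r0 Hr] := near_half_negligible n0_gt0 n3 G_process G0_initial.
have off i (s : R) : `|s| <= 1 -> {ae P, forall w, forall k T0,
    ~ forall t, (T0 <= t)%N -> k.+1%:R^-1 <= s * dev w i t}.
  move=> s1; apply/ae_foralln => k; apply/ae_foralln => T0.
  have k0 : 0 < k.+1%:R^-1 :> R by rewrite invr_gt0.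
  apply: negligibleS (off_equilibrium_negligible n0_gt0 i T0 G_process G0_initial s1 k0).
  by move=> w /= /contrapT.
have half : {ae P, forall w, forall T0, ~ forall t, (T0 <= t)%N ->
    forall i, `|Z w i t - 1/2| <= r}.
  apply/ae_foralln => T0; apply: negligibleS (Hr T0).
  by move=> w /= /contrapT.
have off_all : {ae P, forall w, forall i, forall s : bool, forall k T0,
    ~ forall t, (T0 <= t)%N -> k.+1%:R^-1 <= (-1) ^+ s * dev w i t}.
  have sgn1 (s : bool) : `|(-1) ^+ s : R| <= 1 by rewrite normrX normrN1 expr1n.
  apply: filter_forall => i; apply: filter_forall => s; exact: off.
apply: filterS2 half off_all => w half off_all cvgZ.
have /cvg_ex[L ZL] := cvgZ; pose l i := L ord0 i.
have Zl i : Z w i t @[t --> \oo] --> l i.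
  have := cvg_comp _ _ ZL (@coord_continuous R 1 3 ord0 i L).
  by apply: cvg_trans; apply: near_eq_cvg; near=> t; rewrite /= mxE.
have l01 i : 0 <= l i <= 1.
  rewrite -(cvg_lim (@Rhausdorff R) (Zl i)); apply/andP; split.
    apply: limr_ge; first by apply/cvg_ex; exists (l i).
    by apply: nearW => t; have /andP[] := red_proportion_itv R (G t w) i.
  apply: limr_le; first by apply/cvg_ex; exists (l i).
  by apply: nearW => t; have /andP[] := red_proportion_itv R (G t w) i.
have equilibrium i : red_prob n (l (prev i)) = l i.
  apply/eqP; rewrite -subr_eq0; apply/negP => /negP; set e := _ - _ => e0.
  have dev_e : (-1) ^+ (e < 0)%R * dev w i t @[t --> \oo] --> `|e|.
    rewrite normrEsign; apply: cvgMr; apply: cvgB; last exact: Zl.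
    by apply: continuous_cvg; [exact: continuous_red_prob|exact: Zl].
  have e2 : 0 < `|e| / 2 by rewrite divr_gt0// normr_gt0.
  have [k _ /(_ k (leqnn k)) Hk] := near_infty_natSinv_lt (PosNum e2).
  have e2_lt : `|e| / 2 < `|e| by lra.
  have [T0 _ HT0] := cvgr_gt _ dev_e _ e2_lt.
  apply: (off_all i (e < 0)%R k T0) => t /HT0/ltW; apply: le_trans; exact: ltW.
have l_half := equilibrium_half l01 equilibrium.
have [T0 _ HT0] : \forall t \near \oo, forall i, `|Z w i t - 1/2| <= r.
  apply: filter_forall => i; have /cvgrPdist_le/(_ r r0) := Zl i.
  by apply: filterS => t; rewrite l_half distrC.
exact: (half T0).
Unshelve. all: by end_near.
Qed.
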